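(* The $G$-action on $\mathbb Z\backslash G^{\mathbb Z}$ is ergodic for $\widehat{\mathbb Q}$, and the $\mathbb Z$-action on $G^{\mathbb Z}/G$ is ergodic for $\bar{\mathbb P}_o$.
   Context: $G$ is a non-elementary Gromov-hyperbolic group with identity $o$, $S$ a finite symmetric generating set, $\mu$ a symmetric probability measure on $G$ with support $S$. $F(x,y)$ is the probability that the random walk $xY_1\cdots Y_n$ ($Y_i$ i.i.d. of law $\mu$, $n\ge0$) ever visits $y$, and $d_{\mathcal G}(x,y)=-\log F(x,y)$ is the Green metric. $G^{\mathbb Z}$ is the space of bi-infinite paths $(x_z)_{z\in\mathbb Z}$ in $G$, with commuting actions $g.(x_z)_z=(gx_z)_z$ of $G$ and $k.(x_z)_z=(x_{z-k})_z$ of $\mathbb Z$. $\bar{\mathbb P}_g$ is the law on $G^{\mathbb Z}$ of $(X_z)_z$ with $X_z=Z_z$ for $z\ge0$, $X_z=\bar Z_{-z}$ for $z<0$, where $(Z_n)$, $(\bar Z_n)$ are independent random walks started at $g$ with step distribution $\mu$. $\mathbb Q=\sum_{g\in G}\bar{\mathbb P}_g$. Quotient by $G$: $G^{\mathbb Z}/G$ is identified with the fundamental domain $G^{\mathbb Z}_o=\{(x_z)_z:x_0=o\}$ equipped with $\bar{\mathbb P}_o$; the induced $\mathbb Z$-action is $\tau_z(x_n)_{n\in\mathbb Z}=x_{-z}^{-1}(x_{n-z})_{n\in\mathbb Z}$. Quotient by $\mathbb Z$: up to $\mathbb Q$-null sets (paths not leaving every finite set), $\mathbb Z\backslash G^{\mathbb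 Z}$ is identified with the fundamental domain $$\mathcal D=\bigcup_{g\in G}\{(x_z)_z: x_0=g,\ d_{\mathcal G}(x_z,o)>d_{\mathcal G}(x_0,o)\ \forall z<0,\ d_{\mathcal G}(x_z,o)\ge d_{\mathcal G}(x_0,o)\ \forall z>0\},$$ equipped with $\widehat{\mathbb Q}(B)=\mathbb Q(B\cap\mathcal D)$; the induced $G$-action sends $x\in\mathcal D$ to the unique $\mathbb Z$-shift of $gx$ lying in $\mathcal D$. A quasi-invariant measure $m$ is ergodic if every measurable $A$ invariant modulo $m$-null sets satisfies $m(A)=0$ or $m(A^c)=0$. *)

(* Defs.v *)
From HB Require Import structures.
From mathcomp Require Import all_boot all_order all_algebra.
From mathcomp Require Import all_classical all_reals all_analysis.

Set Implicit Arguments.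
Unset Strict Implicit.
Unset Printing Implicit Defensive.

Import Order.TTheory GRing.Theory Num.Theory.

Local Open Scope classical_set_scope.
Local Open Scope ring_scope.

Section groups.
Context (G : groupType).
Implicit Types (S : set G) (w : seq G) (g x y : G) (n : nat).

Definition symmetric_set S := forall g, S g -> S (g^-1)%g.

Definition word_in S w := forall s, s \in w -> S s \/ S (s^-1)%g.

Definition generating S :=
  forall g, exists2 w, word_in S w & g = (\prod_(s <- w) s)%g.

Definition expressible S g n :=
  exists w, [/\ word_in S w, size w = n & g = (\prod_(s <- w) s)%g].

(* the least length of a word representing g; the default value 0 is only
   reached when S does not generate g *)
Definition word_length S g : nat :=
  xget 0%N [set n | expressible S g n /\
                    forall m, expressible S g m -> (n <= m)%N].

Definition word_dist S x y : nat := word_length S (x^-1 * y)%g.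

(* elementary = virtually cyclic (finite groups included): some cyclic
   subgroup <c> has finitely many left cosets, represented by T *)
Definition elementary :=
  exists c : G, exists2 T : set G, finite_set T &
    forall g, exists2 t, T t & exists n, g = (t * c ^+ n)%g \/ g = (t * c ^- n)%g.

End groups.

Section hyperbolicity.
Context (R : realType).

Definition gromov_product (T : Type) (d : T -> T -> R) (w x y : T) : R :=
  (d x w + d y w - d x y) / 2.

Definition gromov_hyperbolic (T : Type) (d : T -> T -> R) :=
  exists delta : R, forall w x y z,
    Num.min (gromov_product d w x y) (gromov_product d w y z) - delta
      <= gromov_product d w x z.

Definition hyperbolic_group (G : groupType) :=
  exists S : set G, [/\ finite_set S, generating S &
    gromov_hyperbolic (fun x y => (word_dist S x y)%:R : R)].

End hyperbolicity.

Section random_walk.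
Context (R : realType) (G : groupType).
Local Open Scope ereal_scope.

(* probability measures on the (discrete, countable) group G are given by
   their mass functions *)
Definition prob_mass (mu : G -> R) :=
  (forall g, 0 <= mu g)%R /\ \esum_(g in [set: G]) (mu g)%:E = 1.

Definition mass_support (mu : G -> R) : set G := [set g | mu g != 0%R].

Context d (Omega : measurableType d) (P : probability Omega R).

(* G carries the discrete sigma-algebra, so every subset of G is an event *)
Definition G_random_variable (Y : Omega -> G) :=
  forall A : set G, measurable (Y @^-1` A).

Definition has_law (mu : G -> R) (Y : Omega -> G) :=
  forall A : set G, P (Y @^-1` A) = \esum_(g in A) (mu g)%:E.

Definition mutually_independent (I : choiceType) (Y : I -> Omega -> G) :=
  forall (J : seq I) (A : I -> set G), uniq J ->
    P (\bigcap_(i in [set` J]) (Y i @^-1` A i)) = \prod_(i <- J) P (Y i @^-1` A i).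

Definition iid (mu : G -> R) (I : choiceType) (Y : I -> Omega -> G) :=
  [/\ forall i, G_random_variable (Y i),
      forall i, has_law mu (Y i) & mutually_independent Y].

(* two sequences of steps that are jointly i.i.d. drive two independent walks *)
Definition two_walk_steps (mu : G -> R) (Y Y' : nat -> Omega -> G) :=
  iid mu (fun i : nat + nat => match i with inl n => Y n | inr n => Y' n end).

Definition walk (Y : nat -> Omega -> G) (x : G) (n : nat) (omega : Omega) : G :=
  (x * \prod_(0 <= i < n) Y i omega)%g.

Definition hitting_prob (Y : nat -> Omega -> G) (x y : G) : \bar R :=
  P [set omega | exists n, walk Y x n omega = y].

Definition green_dist (Y : nat -> Omega -> G) (x y : G) : R :=
  (- ln (fine (hitting_prob Y x y)))%R.

End random_walk.

Section path_space.
Context (G : groupType).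

Definition bipath : Type := int -> G.

Definition cylinders : set (set bipath) :=
  [set C | exists (z : int) (A : set G), C = [set x : bipath | A (x z)]].

HB.instance Definition _ := gen_eqMixin bipath.
HB.instance Definition _ := gen_choiceMixin bipath.
HB.instance Definition _ := isPointed.Build bipath (fun=> 1%g).

HB.instance Definition _ := @isMeasurable.Build (sigma_display cylinders)
  bipath <<s cylinders >> (@sigma_algebra0 _ setT cylinders)
  (@sigma_algebraC _ cylinders) (@sigma_algebra_bigcup _ setT cylinders).

Definition translate (g : G) (x : bipath) : bipath := fun z => (g * x z)%g.

Definition path_shift (k : int) (x : bipath) : bipath := fun z => x (z - k).

(* fundamental domain of the G-action, and the induced Z-action *)
Definition based_paths : set bipath := [set x : bipath | x 0 = 1%g].

Definition tau (z : int) (x : bipath) : bipath :=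
  fun n => ((x (- z))^-1 * x (n - z))%g.

Context (R : realType).

(* fundamental domain of the Z-action, for a metric dG on G *)
Definition fundamental_domain (dG : G -> G -> R) : set bipath :=
  [set x : bipath | (forall z : int, z < 0 -> dG (x 0) 1%g < dG (x z) 1%g) /\
    (forall z : int, 0 < z -> dG (x 0) 1%g <= dG (x z) 1%g)].

(* A Z-orbit meets the fundamental domain in at most one path; on the null set
   where the orbit of g.x misses it, the value is x by convention. *)
Definition domain_action (dG : G -> G -> R) (g : G) (x : bipath) : bipath :=
  xget x [set y | fundamental_domain dG y /\
                  exists k : int, y = path_shift k (translate g x)].

End path_space.

Section path_measures.
Context (R : realType) (G : groupType) d (Omega : measurableType d)
        (P : probability Omega R) (Y Y' : nat -> Omega -> G).
Local Open Scope ereal_scope.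

(* Negz n is the integer -(n+1) *)
Definition bilateral_walk (g : G) (omega : Omega) : bipath G :=
  fun z => match z with
           | Posz n => walk Y g n omega
           | Negz n => walk Y' g n.+1 omega
           end.

Definition path_law (g : G) : set (bipath G) -> \bar R :=
  pushforward P (bilateral_walk g).

Definition path_measure (B : set (bipath G)) : \bar R :=
  \esum_(g in [set: G]) path_law g B.

Definition quotient_measure (B : set (bipath G)) : \bar R :=
  path_measure (B `&` fundamental_domain (green_dist P Y)).

End path_measures.

Section ergodicity.
Context d (T : measurableType d) (R : realType) (I : Type).
Local Open Scope ereal_scope.

(* action of I (by self-maps of X, up to null sets) on the space X, a subset of
   T, endowed with the restriction of m *)
Context (X : set T) (act : I -> T -> T) (m : set T -> \bar R).

Definition quasi_invariant :=
  forall i A, measurable A -> A `<=` X ->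
    m.-negligible (X `&` act i @^-1` A) <-> m.-negligible A.

Definition invariant_mod_null (A : set T) :=
  forall i, m.-negligible (A `+` (X `&` act i @^-1` A)).

Definition ergodic :=
  quasi_invariant /\
  forall A, measurable A -> A `<=` X -> invariant_mod_null A ->
    m A = 0 \/ m (X `\` A) = 0.

End ergodicity.

(* Main.v *)
(* Lifting a path to its increments turns the bilateral walk into an i.i.d.
   family indexed by Z on which tau acts as the Bernoulli shift, so tau is
   ergodic because measurable events are approximated by events depending on
   finitely many increments.

   For the other quotient, a set A of D that is invariant modulo null sets is
   saturated by shifts and then intersected over the translates by G; the result
   is invariant under both actions and hence null or conull. This needs that
   almost every Z-orbit meets D. If F(.,o) is identically 1, then D is empty.
   Otherwise the walk is transient: decomposing along the last visit to o, the
   expected number of visits is finite, and a maximal inequality bounds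
   e * P(F(x_n,o) >= e for some n >= N) by the probability of visiting o after
   time N. Hence F(x_z,o) tends to 0 at both ends of almost every path, and the
   first maximum of F(x_z,o) gives the point of D on its orbit. *)
Require Import Defs.
From HB Require Import structures.
From mathcomp Require Import all_boot all_order all_algebra.
From mathcomp Require Import all_classical all_reals all_analysis.
From mathcomp Require Import zify lra.

Set Implicit Arguments.
Unset Strict Implicit.
Unset Printing Implicit Defensive.

Import Order.TTheory GRing.Theory Num.Theory.
Local Open Scope classical_set_scope.
Local Open Scope ring_scope.

(** * Countable unions and countable groups *)

Section countable_index.
Local Open Scope ereal_scope.
Context d (T : measurableType d) (R : realType).

Lemma measure_countable_bigcup0 (mu : {measure set T -> \bar R}) (I : Type)
    (F : I -> set T) :
  countable [set: I] -> (forall i, measurable (F i)) ->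
  (forall i, mu (F i) = 0) -> mu (\bigcup_i F i) = 0.
Proof.
move=> /countable_injP[f finj] mF F0.
(* Injectivity of [f] makes each [H n] empty or a single [F i], so the union is that of a
   sequence. *)
pose H n := \bigcup_(i in f @^-1` [set n]) F i.
have Hn n : H n = set0 \/ exists i, H n = F i.
  have [[i fi]|nofi] := pselect (exists i, f i = n).
    right; exists i; apply/seteqP; split => [t [j fj Fj]|t Fi]; last by exists i.
    by have -> // : i = j by apply: finj; rewrite ?inE //= fi fj.
  by left; rewrite -subset0 => t [i fi _]; apply: nofi; exists i.
have -> : \bigcup_i F i = \bigcup_n H n.
  apply/seteqP; split => [t [i _ Fi]|t [n _ [i _ Fi]]]; last by exists i.
  by exists (f i) => //; exists i.
have mU : measurable (\bigcup_n H n).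
  by apply: bigcup_measurable => n _; have [->|[i ->]] := Hn n.
have [|B [mB B0 UB]] := @negligible_bigcup _ _ _ mu H.
  move=> n; have [->|[i ->]] := Hn n; first exact: negligible_set0.
  by exists (F i); split.
exact: subset_measure0 UB B0.
Qed.

(** The bounds on the cells are summed. Only [a] has to be covered: what [b] has outside the cells
    only helps. With cells given by a stopping time and the position at that time, this yields a
    maximal inequality. *)
Lemma ge_measure_partition (P : {measure set T -> \bar R}) (I : Type)
    (D : I -> set T) (a b : set T) (c : R) :
  countable [set: I] -> (forall i, measurable (D i)) -> trivIset [set: I] D ->
  (0 <= c)%R -> measurable a -> measurable b -> a `<=` \bigcup_i D i ->
  (forall i, c%:E * P (a `&` D i) <= P (b `&` D i)) ->
  c%:E * P a <= P b.
Proof.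
move=> /countable_injP[f finj] mD tD c0 ma mb aD leab.
pose H n := \bigcup_(i in f @^-1` [set n]) D i.
have Hn n : H n = set0 \/ exists i, H n = D i.
  have [[i fi]|nofi] := pselect (exists i, f i = n).
    right; exists i; apply/seteqP; split => [t [j fj Fj]|t Fi]; last by exists i.
    by have -> // : i = j by apply: finj; rewrite ?inE //= fi fj.
  by left; rewrite -subset0 => t [i fi _]; apply: nofi; exists i.
have mH n : measurable (H n) by have [->|[g ->]] := Hn n.
have PE e : measurable e -> P (e `&` \bigcup_n H n) = \sum_(n <oo) P (e `&` H n).
  move=> me; rewrite setI_bigcupr measure_semi_bigcup //=.
  - by move=> n; exact: measurableI.
  - move=> m n _ _ [t [[_ [i fi Di]] [_ [j fj Dj]]]].
    by rewrite -fi -fj; congr f; apply: tD => //; exists t.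
  - by apply: bigcup_measurable => n _; exact: measurableI.
have -> : P a = \sum_(n <oo) P (a `&` H n).
  rewrite -PE //; congr (P _); apply/seteqP; split => [t at_|t []//]; split => //.
  by have [i _ Di] := aD _ at_; exists (f i) => //; exists i.
rewrite -nneseriesZl //.
have mU : measurable (\bigcup_n H n) by exact: bigcup_measurable.
apply: (@le_trans _ _ (P (b `&` \bigcup_n H n))); last first.
  by rewrite le_measure ?inE //; exact: measurableI.
rewrite PE //; apply: lee_nneseries => [n _ _|n _].
  by rewrite mule_ge0 ?lee_fin ?measure_ge0.
have [->|[i ->//]] := Hn n; by rewrite !setI0 !measure0 mule0.
Qed.

End countable_index.

Section countable_group.
Context (G : groupType).
Implicit Types (A : set G).

(** A word is coded by the positions of its letters in the list of elements of [S] followed by their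
    inverses, so [G] is an image of [seq nat]. *)
Lemma generating_countable (S : set G) :
  finite_set S -> generating S -> countable [set: G].
Proof.
move=> /finite_seqP[s Ss] genS.
pose l := s ++ [seq x^-1%g | x <- s].
have surj : [set: G] `<=` (fun w : seq nat => \prod_(i <- w) nth 1%g l i)%g @` setT.
  move=> g _; have [w wS ->] := genS g.
  exists [seq index x l | x <- w] => //.
  rewrite big_map [LHS]big_seq_cond [RHS]big_seq_cond.
  apply: eq_bigr => x; rewrite andbT => /wS xS; apply: nth_index.
  rewrite /l mem_cat; case: xS; rewrite Ss /= => xs; first by rewrite xs.
  by apply/orP; right; apply/mapP; exists (x^-1)%g => //; rewrite invgK.
apply: sub_countable (countableP [set: seq nat]).
by apply: card_le_trans (card_image_le _ _); exact: subset_card_le surj.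
Qed.

Hypothesis cG : countable [set: G].
Context d (T : measurableType d).
Implicit Types X Z : T -> G.

Lemma G_random_variable_const (g : G) : G_random_variable (fun _ : T => g).
Proof.
move=> A; have [Ag|nAg] := pselect (A g).
  by rewrite (_ : _ @^-1` _ = setT) //; apply/seteqP; split.
by rewrite (_ : _ @^-1` _ = set0) // -subset0 => t /nAg.
Qed.

(** Splitting by the value of [X] gives a union of intersections of two events, indexed by the
    countable group. *)
Lemma G_random_variable_rel X Z (Q : G -> G -> Prop) :
  G_random_variable X -> G_random_variable Z ->
  measurable [set t | Q (X t) (Z t)].
Proof.
move=> mX mZ.
rewrite (_ : [set _ | _] = \bigcup_g (X @^-1` [set g] `&` Z @^-1` (Q g))).
  by apply: countable_bigcupT_measurable => // g; exact: measurableI.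
by apply/seteqP; split => [t QXZ|t [g _ [/= -> ]]] //; exists (X t).
Qed.

Lemma G_random_variable_comp2 X Z (f : G -> G -> G) :
  G_random_variable X -> G_random_variable Z ->
  G_random_variable (fun t => f (X t) (Z t)).
Proof. by move=> mX mZ A; exact: (G_random_variable_rel (fun g h => A (f g h))). Qed.

Lemma G_random_variable_comp X (f : G -> G) :
  G_random_variable X -> G_random_variable (fun t => f (X t)).
Proof. by move=> mX A; exact: (mX (f @^-1` A)). Qed.

Lemma G_random_variable_prod (X : nat -> T -> G) m n :
  (forall i, G_random_variable (X i)) ->
  G_random_variable (fun t => \prod_(m <= i < n) X i t)%g.
Proof.
move=> mX; elim: n => [|n IHn].
  by under eq_fun do rewrite big_geq //; exact: G_random_variable_const.
have [mn|nm] := leqP m n.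
  under eq_fun do rewrite big_nat_recr //.
  exact: (G_random_variable_comp2 (fun g h => g * h)%g).
by under eq_fun do rewrite big_geq //; exact: G_random_variable_const.
Qed.

Lemma G_random_variable_bipath (f : T -> bipath G) :
  (forall z, G_random_variable (fun t => f t z)) -> measurable_fun setT f.
Proof.
move=> mf; apply: (measurability (cylinders (G := G))) => //.
by move=> _ [_ [z [A ->]] <-]; rewrite setTI; exact: mf.
Qed.

End countable_group.

Lemma G_random_variable_coord (G : groupType) (z : int) :
  G_random_variable (fun x : bipath G => x z).
Proof. by move=> A; apply: sub_sigma_algebra; exists z, A. Qed.

(** * Independence and laws on the path space *)

Section finite_cylinders.
Context (G : groupType).
Implicit Types (L : seq int) (A : int -> set G).

(** Unlike the one-coordinate [cylinders], these sets are closed under intersection and so form a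
    pi-system. *)
Definition fcyl L A : set (bipath G) :=
  [set x | forall z, z \in L -> A z (x z)].

Lemma fcylE L A : fcyl L A = \bigcap_(z in [set` L]) [set x | A z (x z)].
Proof. by apply/seteqP; split => x. Qed.

Lemma fcyl_undup L A : fcyl (undup L) A = fcyl L A.
Proof. by apply/seteqP; split => x xA z zL; apply: xA; rewrite mem_undup in zL *. Qed.

Lemma measurable_fcyl L A : measurable (fcyl L A).
Proof.
rewrite fcylE; apply: fin_bigcap_measurable => // z _.
exact: G_random_variable_coord.
Qed.

Lemma fcylI L A L' A' : fcyl L A `&` fcyl L' A' =
  fcyl (L ++ L') (fun z => [set g | (z \in L -> A z g) /\ (z \in L' -> A' z g)]).
Proof.
apply/seteqP; split => [x [xA xA'] z _|x xA]; first by split; [exact: xA|exact: xA'].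
by split => z zL; have [|+ +] := xA z; rewrite ?mem_cat ?zL ?orbT //; auto.
Qed.

(** The pi-lambda theorem for finite cylinders. Duplicates in [L] can be removed without changing
    the cylinder, which matches the [uniq] lists in the definition of independence. *)
Lemma bipath_dynkin (Q : set (set (bipath G))) :
  (forall L A, uniq L -> Q (fcyl L A)) ->
  (forall B, measurable B -> Q B -> Q (~` B)) ->
  (forall F : (set (bipath G))^nat, (forall n, measurable (F n)) ->
     trivIset [set: nat] F -> (forall n, Q (F n)) -> Q (\bigcup_k F k)) ->
  forall B, measurable B -> Q B.
Proof.
move=> Qcyl QC QU.
pose C := [set B | exists L A, B = fcyl L A].
have mE : @measurable _ (bipath G) = <<s C >>.
  apply/seteqP; split.
    apply: smallest_sub; first exact: smallest_sigma_algebra.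
    move=> _ [z [A ->]]; apply: sub_sigma_algebra; exists [:: z], (fun=> A).
    by apply/seteqP; split => x xA => [y|];
      [rewrite inE => /eqP ->|exact/xA/mem_head].
  apply: smallest_sub; first exact: sigma_algebra_measurable.
  by move=> _ [L [A ->]]; exact: measurable_fcyl.
move=> B mB; apply: (dynkin_induction mE); last by rewrite -mE.
- by move=> _ _ [L [A ->]] [L' [A' ->]]; rewrite fcylI; do 2 eexists.
- rewrite (_ : setT = fcyl [::] (fun=> setT)); first exact: Qcyl.
  by apply/seteqP; split.
- by move=> _ [L [A ->]]; rewrite -fcyl_undup; apply: Qcyl; exact: undup_uniq.
- exact: QC.
- exact: QU.
Qed.

End finite_cylinders.

Lemma preimage_measurable d d' (T : measurableType d) (T' : measurableType d')
  (f : T -> T') (B : set T') :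
  measurable_fun setT f -> measurable B -> measurable (f @^-1` B).
Proof. by move=> mf mB; rewrite -[X in measurable X]setTI; exact: mf. Qed.

Section dynkin_consequences.
Local Open Scope ereal_scope.
Context (R : realType) (G : groupType).

Lemma eq_law d d' (T : measurableType d) (T' : measurableType d')
    (P : probability T R) (P' : probability T' R)
    (f : T -> bipath G) (f' : T' -> bipath G) :
  measurable_fun setT f -> measurable_fun setT f' ->
  (forall L A, uniq L -> P (f @^-1` fcyl L A) = P' (f' @^-1` fcyl L A)) ->
  forall B, measurable B -> P (f @^-1` B) = P' (f' @^-1` B).
Proof.
move=> mf mf' PP'; apply: bipath_dynkin => // [B mB PB|F mF tF PF].
  have mfB := preimage_measurable mf mB; have mfB' := preimage_measurable mf' mB.
  by rewrite (probability_setC P mfB) (probability_setC P' mfB') PB.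
have mU : measurable (\bigcup_n F n) by exact: bigcup_measurable.
have sumE d0 (T0 : measurableType d0) (P0 : probability T0 R) (g : T0 -> bipath G) :
    measurable_fun setT g ->
    P0 (g @^-1` \bigcup_n F n) = \sum_(n <oo) P0 (g @^-1` F n).
  move=> mg; rewrite preimage_bigcup measure_semi_bigcup //.
  - by move=> n; exact: preimage_measurable.
  - by move=> i j _ _ [t Ft]; apply: tF => //; exists (g t).
  - by rewrite -preimage_bigcup; exact: preimage_measurable.
by rewrite (sumE _ _ P f mf) (sumE _ _ P' f' mf'); apply: eq_eseriesr.
Qed.

(** The sets whose preimage is independent of [E] form a Dynkin class. As [E] is arbitrary, two uses
    of this lemma free both events from being cylinders. *)
Lemma indep_event d (T : measurableType d) (P : probability T R) (E : set T)
    (f : T -> bipath G) :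
  measurable E -> measurable_fun setT f ->
  (forall L A, uniq L ->
     P (E `&` f @^-1` fcyl L A) = P E * P (f @^-1` fcyl L A)) ->
  forall B, measurable B -> P (E `&` f @^-1` B) = P E * P (f @^-1` B).
Proof.
move=> mE mf PL.
have finE : P E \is a fin_num by exact: fin_num_measure.
apply: bipath_dynkin => // [B mB PB|F mF tF PF].
  have mfB : measurable (f @^-1` B) by exact: preimage_measurable.
  have -> : E `&` f @^-1` (~` B) = E `\` f @^-1` B by [].
  have -> : f @^-1` (~` B) = ~` (f @^-1` B) by [].
  have Elty : P E < +oo by rewrite ltey_eq finE.
  have DE : P (E `\` f @^-1` B) = P E - P (E `&` f @^-1` B) by exact: measureD.
  rewrite DE PB (probability_setC P mfB) muleBr ?mule1 //.
have mU : measurable (\bigcup_n F n) by exact: bigcup_measurable.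
have mfF n : measurable (f @^-1` F n) by exact: preimage_measurable.
have tfF : trivIset setT (fun n => f @^-1` F n).
  by move=> i j _ _ [t Ft]; apply: tF => //; exists (f t).
have mUf : measurable (\bigcup_n (f @^-1` F n)) by exact: bigcup_measurable.
rewrite preimage_bigcup setI_bigcupr (measure_semi_bigcup P mfF tfF mUf).
rewrite measure_semi_bigcup //.
- rewrite -(fineK finE) -nneseriesZl //; apply: eq_eseriesr => n _.
  by rewrite (fineK finE); exact: PF.
- by move=> n; exact: measurableI.
- by move=> i j _ _ [t [[_ Fi] [_ Fj]]]; apply: tfF => //; exists t.
- by rewrite -setI_bigcupr; exact: measurableI.
Qed.

End dynkin_consequences.

Section iid_sequences.
Local Open Scope ereal_scope.
Context (R : realType) (G : groupType) (mu : G -> R).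

Lemma iid_fcyl d (T : measurableType d) (P : probability T R)
    (V : int -> T -> G) (L : seq int) (A : int -> set G) :
  iid P mu V -> uniq L ->
  P ((fun t => (V^~ t : bipath G)) @^-1` fcyl L A) =
  \prod_(z <- L) \esum_(g in A z) (mu g)%:E.
Proof.
move=> [_ lawV indV] uL; rewrite fcylE preimage_bigcap.
by rewrite (indV L A uL); apply: eq_bigr => z _; exact: lawV.
Qed.

Lemma measurable_iid d (T : measurableType d) (P : probability T R)
    (V : int -> T -> G) :
  iid P mu V -> measurable_fun setT (fun t => (V^~ t : bipath G)).
Proof. by case=> mV _ _; exact: G_random_variable_bipath. Qed.

Lemma iid_eq_law d d' (T : measurableType d) (T' : measurableType d')
    (P : probability T R) (P' : probability T' R)
    (V : int -> T -> G) (V' : int -> T' -> G) :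
  iid P mu V -> iid P' mu V' -> forall B : set (bipath G), measurable B ->
  P [set t | B (V^~ t)] = P' [set t | B (V'^~ t)].
Proof.
move=> iV iV'; apply: (@eq_law _ _ _ _ _ _ P P' (fun t => (V^~ t : bipath G))
  (fun t => (V'^~ t : bipath G))).
- exact: measurable_iid iV.
- exact: measurable_iid iV'.
- by move=> L A uL; rewrite (iid_fcyl A iV uL) (iid_fcyl A iV' uL).
Qed.

Hypothesis sym_mu : forall g, mu (g^-1)%g = mu g.

(** Injective relabelling preserves independence, and inverting some of the variables preserves
    their law because [mu] is symmetric. The shift, time reversal and the gluing of the two walks
    are all instances. *)
Lemma iid_signed_reindex d (T : measurableType d) (P : probability T R)
    (I K : choiceType) (V : I -> T -> G) (f : K -> I) (s : K -> bool) :
  injective f -> iid P mu V ->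
  iid P mu (fun k t => if s k then (V (f k) t)^-1%g else V (f k) t).
Proof.
move=> finj [mV lawV indV].
pose A' (A : K -> set G) k := if s k then [set g | A k (g^-1)%g] else A k.
have preE A k : (fun t => if s k then (V (f k) t)^-1%g else V (f k) t) @^-1` A k
    = V (f k) @^-1` A' A k.
  by apply/seteqP; rewrite /A'; split => t /=; case: (s k).
split.
- move=> k A; rewrite (preE (fun=> A)); exact: mV.
- move=> k A; rewrite (preE (fun=> A)) lawV /A'; case: (s k) => //.
  rewrite [RHS](reindex_esum [set g | A (g^-1)%g] A (fun g => g^-1)%g).
    by apply: eq_esum => g _; rewrite sym_mu.
  split=> //; first by move=> g h _ _; exact: invg_inj.
  by move=> g Ag; exists (g^-1)%g; rewrite /= ?invgK.
- move=> J A uJ.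
  (* The constraints are carried along [f], with no constraint off the image of [J]. *)
  pose B i := if pselect (exists2 k, k \in J & f k = i) is left e
              then A' A (projT1 (cid2 e)) else setT.
  have BE k : k \in J -> B (f k) = A' A k.
    move=> kJ; rewrite /B; case: pselect => [e|[]]; last by exists k.
    by case: cid2 => k' k'J /= /finj ->.
  have uJ' : uniq (map f J) by rewrite map_inj_uniq.
  have := indV _ B uJ'; rewrite big_map => eB.
  transitivity (\prod_(j <- J) P (V (f j) @^-1` B (f j))); last first.
    by apply: eq_big_seq => k kJ; rewrite (preE A) BE.
  rewrite -eB; congr (P _); apply/seteqP; split => t tA.
    move=> i /= /mapP[k kJ ->]; rewrite BE //.
    by have := tA k kJ; rewrite (preE A).
  move=> k kJ; rewrite (preE A) -BE //; apply: (tA (f k)) => /=.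
  exact: map_f.
Qed.

End iid_sequences.

(** These are the increments of the time-reversed path: its step at time z undoes the step of the
    original from -z-1 to -z. *)
Definition reverse_increments (G : groupType) (u : bipath G) : bipath G :=
  fun z => (u (- z - 1))^-1%g.

(** For measurable [B], this replaces measurability with respect to the coordinates in [J]. *)
Definition determined (G : groupType) (J : {pred int}) (B : set (bipath G)) :=
  forall u v : bipath G, {in J, u =1 v} -> B u -> B v.

Section canonical_iid.
Local Open Scope ereal_scope.
Context (R : realType) (G : groupType) (mu : G -> R).
Hypothesis hmu : prob_mass mu.
Hypothesis sym_mu : forall g, mu (g^-1)%g = mu g.
Context (nu : probability (bipath G) R).
Hypothesis iid_nu : iid nu mu (fun z (u : bipath G) => u z).

Lemma measurable_shift k : measurable_fun setT (@path_shift G k).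
Proof. by apply: G_random_variable_bipath => z; exact: G_random_variable_coord. Qed.

Lemma measurable_reverse : measurable_fun setT (@reverse_increments G).
Proof.
by apply: G_random_variable_bipath => z;
  apply: (G_random_variable_comp (fun g => g^-1)%g); exact: G_random_variable_coord.
Qed.

Lemma shift_invariant k B : measurable B -> nu (path_shift k @^-1` B) = nu B.
Proof.
move=> mB; have inj : injective (fun z : int => (z - k)%R) by exact: addIr.
have iV := iid_signed_reindex sym_mu (fun=> false) inj iid_nu.
exact: (iid_eq_law iV iid_nu mB).
Qed.

Lemma reverse_invariant B :
  measurable B -> nu (@reverse_increments G @^-1` B) = nu B.
Proof.
move=> mB; have inj : injective (fun z : int => (- z - 1)%R).
  by move=> y z /addIr/oppr_inj.
have iV := iid_signed_reindex sym_mu (fun=> true) inj iid_nu.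
exact: (iid_eq_law iV iid_nu mB).
Qed.

Let law (A : set G) := \esum_(g in A) (mu g)%:E.

(** Resetting the coordinates outside [J] makes any set determined by [J] its own preimage, so that
    independence can be tested on cylinders. *)
Let restr (J : {pred int}) (u : bipath G) : bipath G :=
  fun z => if z \in J then u z else 1%g.

Let measurable_restr J : measurable_fun setT (restr J).
Proof.
apply: G_random_variable_bipath => z; rewrite /restr; case: (z \in J);
  first exact: G_random_variable_coord.
exact: G_random_variable_const.
Qed.

Let restrA (J : {pred int}) (A : int -> set G) z : set G :=
  if z \in J then A z else [set _ | A z 1%g].

Let restr_fcyl J L A : restr J @^-1` fcyl L A = fcyl L (restrA J A).
Proof.
by apply/seteqP; rewrite /restr /restrA; split => u uA z zL /=;
  have := uA z zL; case: (z \in J).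
Qed.

Let nu_fcyl L A : uniq L -> nu (fcyl L A) = \prod_(z <- L) law (A z).
Proof. by move=> uL; have := iid_fcyl A iid_nu uL. Qed.

Let law_cstI (A : set G) (b : Prop) : law (A `&` [set _ | b]) = law
  A * law [set _ | b].
Proof.
have [hb|nb] := pselect b.
  rewrite (_ : [set _ | b] = setT) ?setIT; last by apply/seteqP; split.
  by rewrite /law (proj2 hmu) mule1.
rewrite (_ : [set _ | b] = set0) ?setI0; last by apply/seteqP; split.
by rewrite /law !esum_set0 mule0.
Qed.

Let indep_fcyl J K L A L' A' : (forall z, z \in J -> z \in K -> False) ->
  uniq L -> uniq L' ->
  nu (restr J @^-1` fcyl L A `&` restr K @^-1` fcyl L' A') =
  nu (restr J @^-1` fcyl L A) * nu (restr K @^-1` fcyl L' A').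
Proof.
move=> JK uL uL'; rewrite !restr_fcyl.
pose M := undup (L ++ L').
pose ext (L0 : seq int) (A0 : int -> set G) z := if z \in L0 then A0 z else setT.
have extE L0 A0 : {subset L0 <= M} -> fcyl L0 A0 = fcyl M (ext L0 A0).
  move=> LM; apply/seteqP; split => u uA z zL.
    by rewrite /ext; case: ifPn => // /uA.
  by have := uA z (LM z zL); rewrite /ext zL.
have LM : {subset L <= M} by move=> z zL; rewrite mem_undup mem_cat zL.
have LM' : {subset L' <= M} by move=> z zL; rewrite mem_undup mem_cat zL orbT.
have uM : uniq M by exact: undup_uniq.
rewrite (extE L) // (extE L') //.
set B := ext L _; set B' := ext L' _.
have -> : fcyl M B `&` fcyl M B' = fcyl M (fun z => B z `&` B' z).
  by apply/seteqP; split => [u [uB uB'] z zM|u uB]; [split; auto|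
     split => z /uB []].
rewrite !nu_fcyl // -big_split /=; apply: eq_bigr => z _.
(* Since [J] and [K] are disjoint, at each z one of the two constraints does not depend on the
   coordinate; it has mass 0 or 1 and factors out. *)
have [zJ|zJ] := boolP (z \in J).
  have /negP/negPf zK : z \in K -> False by exact: JK.
  have [b ->] : exists b : Prop, B' z = [set _ | b].
    rewrite /B' /ext /restrA zK; case: ifP => _; first by eexists.
    by exists True; apply/seteqP; split.
  exact: law_cstI.
have [b ->] : exists b : Prop, B z = [set _ | b].
  rewrite /B /ext /restrA (negPf zJ); case: ifP => _; first by eexists.
  by exists True; apply/seteqP; split.
by rewrite setIC muleC law_cstI.
Qed.

(** Both events are written as preimages under restrictions; the product formula then passes from
    cylinders to one event and afterwards to the other. *)
Lemma determined_indep (J K : {pred int}) B C :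
  (forall z, z \in J -> z \in K -> False) ->
  measurable B -> measurable C -> determined J B -> determined K C ->
  nu (B `&` C) = nu B * nu C.
Proof.
move=> JK mB mC detB detC.
have restrE J' D : determined J' D -> D = restr J' @^-1` D.
  move=> detD; apply/seteqP; split => u; apply: detD => z zJ;
  by rewrite /restr zJ.
rewrite (restrE _ _ detB) (restrE _ _ detC) {detB detC}.
apply: (indep_event _ (measurable_restr K)) => //.
  exact: preimage_measurable.
move=> L A uL; rewrite setIC muleC.
apply: (indep_event _ (measurable_restr J)) mB.
  exact: (preimage_measurable (measurable_restr K) (@measurable_fcyl _ _ _)).
move=> L' A' uL'; apply: indep_fcyl => // z zK zJ; exact: JK zJ zK.
Qed.

End canonical_iid.

Lemma fine_le_subU d (T : measurableType d) (R : realType) (P : probability T R)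
    (A B C : set T) : measurable A -> measurable B -> measurable C ->
  A `<=` B `|` C -> fine (P A) <= fine (P B) + fine (P C).
Proof.
move=> mA mB mC sub.
have fin D : measurable D -> P D \is a fin_num by move=> ?; exact: fin_num_measure.
rewrite -fineD ?fin // fine_le ?fin ?fin_numD ?fin //.
apply: le_trans (le_measure P _ _ sub) _; rewrite ?inE //; first exact: measurableU.
by rewrite measureU2.
Qed.

Lemma measurableY d (T : measurableType d) (A B : set T) :
  measurable A -> measurable B -> measurable (A `+` B).
Proof. by move=> mA mB; apply: measurableU; exact: measurableD. Qed.

(** * Ergodicity of the Bernoulli shift *)

Section approximation.
Context (R : realType) (G : groupType).
Context (nu : probability (bipath G) R).

Definition window (N : nat) : {pred int} := [pred z : int | (absz z <= N)%N].

Lemma determined_sub (J K : {pred int}) (B : set (bipath G)) :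
  {subset J <= K} -> determined J B -> determined K B.
Proof. by move=> JK detB u v uv; apply: detB => z /JK; exact: uv. Qed.

Let approximable (B : set (bipath G)) := forall e : R, 0 < e ->
  exists N C, [/\ measurable C, determined (window N) C & fine (nu (B `+` C)) < e].

Let approximableU B B' : measurable B -> measurable B' ->
  approximable B -> approximable B' -> approximable (B `|` B').
Proof.
move=> mB mB' aB aB' e e0.
have [N [C [mC detC ltC]]] := aB (e / 2) (divr_gt0 e0 (ltr0n _ 2)).
have [N' [C' [mC' detC' ltC']]] := aB' (e / 2) (divr_gt0 e0 (ltr0n _ 2)).
exists (maxn N N'), (C `|` C'); split.
- exact: measurableU.
- have detN : determined (window (maxn N N')) C.
    by apply: determined_sub detC => z; rewrite !inE => ?; rewrite leq_max;
      apply/orP; left.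
  have detN' : determined (window (maxn N N')) C'.
    by apply: determined_sub detC' => z; rewrite !inE => ?; rewrite leq_max;
      apply/orP; right.
  by move=> u v uv [Cu|Cu]; [left; exact: detN uv Cu|right; exact: detN' uv Cu].
- rewrite [ltRHS](splitr e); apply: le_lt_trans (ltrD ltC ltC').
  apply: fine_le_subU; try (by apply: measurableY => //; exact: measurableU).
  move=> u [[[Bu|Bu] nCu]|[[Cu|Cu] nBu]].
  + by left; left; split => // Cu; apply: nCu; left.
  + by right; left; split => // Cu; apply: nCu; right.
  + by left; right; split => // Bu; apply: nBu; left.
  + by right; right; split => // Bu; apply: nBu; right.
Qed.

(** The sets that can be approximated by events depending on a finite window form a Dynkin class
    containing the cylinders. *)
Lemma determined_approximation B : measurable B -> forall e : R, 0 < e ->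
  exists N C, [/\ measurable C, determined (window N) C & fine (nu (B `+` C)) < e].
Proof.
have exact_approx C N : measurable C -> determined (window N) C -> approximable C.
  move=> mC detC e e0; exists N, C; split => //.
  rewrite (_ : C `+` C = set0) ?measure0 //.
  by rewrite -subset0 => u [[]|[]].
move: B; apply: bipath_dynkin.
- move=> L A _; apply: (@exact_approx _ (\max_(z <- L) absz z)%N);
  first exact: measurable_fcyl.
  move=> u v uv uA z zL; rewrite -uv; first exact: uA.
  by rewrite inE; exact: leq_bigmax_seq.
- move=> B mB aB e /aB[N [C [mC detC ltC]]]; exists N, (~` C); split => //.
  + exact: measurableC.
  + by move=> u v uv nCu Cv; apply/nCu/(detC v) => // z zN; rewrite uv.
  + rewrite (_ : ~` B `+` ~` C = B `+` C) //.
    apply/seteqP; split => u [[h1 h2]|[h1 h2]].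
    * by right; split => //; exact: contrapT.
    * by left; split => //; exact: contrapT.
    * by right; split => // /(_ h1).
    * by left; split => // /(_ h1).
- move=> F mF tF aF e e0.
  pose S n := \big[setU/set0]_(i < n) F i.
  have mS n : measurable (S n) by exact: bigsetU_measurable.
  have mU : measurable (\bigcup_n F n) by exact: bigcup_measurable.
  have aS n : approximable (S n).
    elim: n => [|n IHn]; rewrite /S; last first.
      by rewrite big_ord_recr /=; exact: approximableU (mS n) (mF n) IHn (aF n).
    by rewrite big_ord0; by apply: (@exact_approx _ 0%N) => // u v _ [].
  have subS n : S n `<=` \bigcup_n F n.
    by move=> u; rewrite /S -bigcup_mkord => -[i _ Fi]; exists i.
  (* By continuity from below, a finite partial union misses less than e/2; the other e/2 is spent
     on approximating that partial union. *)
  have [n ltn] : exists n, fine (nu (\bigcup_n F n `\` S n)) < e / 2.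
    have cv : (nu (S n) @[n --> \oo] --> nu (\bigcup_n S n))%classic.
      apply: nondecreasing_cvg_mu => //; first exact: bigcup_measurable.
      apply/nondecreasing_seqP => n; apply/subsetPset.
      by rewrite /S big_ord_recr /=; exact: subsetUl.
    have US : \bigcup_n S n = \bigcup_n F n.
      apply/seteqP; split => [u [n _ /subS]|u [n _ Fn]] //.
      by exists n.+1 => //; rewrite /S big_ord_recr /=; right.
    rewrite US in cv.
    have finU : nu (\bigcup_n F n) \is a fin_num by exact: fin_num_measure.
    move: cv; rewrite -(fineK finU) => /fine_cvg/cvgrPdist_lt/(_ (e / 2)).
    move=> /(_ (divr_gt0 e0 (ltr0n _ 2))) [n _ /(_ n (leqnn n))] /= lte.
    exists n; apply: le_lt_trans lte; apply: le_trans (ler_norm _).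
    rewrite lerBrDr; rewrite -fineD ?fin_num_measure //; last exact: measurableD.
    rewrite fine_le ?fin_numD ?fin_num_measure //; try exact: measurableD.
    rewrite -measureU //; try exact: measurableD.
      rewrite le_measure ?inE //; first by apply: measurableU => //;
        exact: measurableD.
      by move=> u [[]|/subS].
    by rewrite -subset0 => u [[_ h] /h].
  have [N [C [mC detC ltC]]] := aS n (e / 2) (divr_gt0 e0 (ltr0n _ 2)).
  exists N, C; split => //.
  rewrite [ltRHS](splitr e); apply: le_lt_trans (ltrD ltn ltC).
  apply: fine_le_subU; try exact: measurableY; try exact: measurableD.
  move=> u [[Fu nCu]|[Cu nFu]].
    have [Su|nSu] := pselect (S n u); last by left.
    by right; left.
  by right; right; split => // /subS.
Qed.

End approximation.

Section shift_ergodic.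
Context (R : realType) (G : groupType) (mu : G -> R).
Hypothesis hmu : prob_mass mu.
Hypothesis sym_mu : forall g, mu (g^-1)%g = mu g.
Context (nu : probability (bipath G) R).
Hypothesis iid_nu : iid nu mu (fun z (u : bipath G) => u z).

(** A mixing argument: [A] is close to an event [C] on a finite window, a far shift of [C] is
    independent of [C], and the shift of [A] agrees with [A] almost surely. Hence the measure of [A]
    equals its square. *)
Lemma shift_ergodic A : measurable A ->
  (forall k, nu (A `+` path_shift k @^-1` A) = 0%E) -> nu A = 0%E \/ nu (~` A) = 0%E.
Proof.
move=> mA invA.
have mshift k B : measurable B -> measurable (@path_shift G k @^-1` B).
  by move=> mB; exact: preimage_measurable (measurable_shift k) mB.
have finA : nu A \is a fin_num by exact: fin_num_measure.
pose m B := fine (nu B).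
have m0 B : 0 <= m B by apply: fine_ge0.
have m1 B : measurable B -> m B <= 1.
  move=> mB; rewrite -[1]/(fine 1%E) /m fine_le ?fin_num_measure //.
  exact: probability_le1.
(* An error of 2e comes from comparing [A] with the intersection of [C] and its shift, and another
   2e from replacing the square of [m C] by that of [m A], both being at most 1. *)
have aa : forall e : R, 0 < e -> `|m A - m A ^+ 2| <= 4 * e.
  move=> e e0; have [N [C [mC detC ltC]]] := determined_approximation nu mA e0.
  (* The window from -N to N has 2N+1 points, so this shift moves it off itself. *)
  pose k : int := (N.*2.+1)%:Z.
  pose C' := path_shift k @^-1` C; pose A' := path_shift k @^-1` A.
  have mC' : measurable C' by exact: mshift.
  have mA' : measurable A' by exact: mshift.
  have CC' : m (C `&` C') = m C ^+ 2.
    pose K : {pred int} := [pred z : int | z + k \in window N].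
    have detC' : determined K C'.
      move=> u v uv; apply: detC => z zN; rewrite /path_shift uv //.
      by rewrite inE subrK.
    rewrite /m (determined_indep hmu iid_nu _ mC mC' detC detC').
      by rewrite fineM ?fin_num_measure // (shift_invariant sym_mu iid_nu k mC) expr2.
    by move=> z; rewrite !inE /k /=; lia.
  have shiftE : m (A' `+` C') = m (A `+` C).
    exact: (congr1 fine (shift_invariant sym_mu iid_nu k (measurableY mA mC))).
  have mAA' : m (A `+` A') = 0 by rewrite /m (invA k).
  have AC1 : m A <= m C + m (A `+` C).
    apply: fine_le_subU => //; first exact: measurableY.
    by move=> u Au; have [Cu|nCu] := pselect (C u); [left|right; left].
  have AC2 : m C <= m A + m (A `+` C).
    apply: fine_le_subU => //; first exact: measurableY.
    by move=> u Au; have [Cu|nCu] := pselect (A u); [left|right; right].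
  have mCC' : measurable (C `&` C') by exact: measurableI.
  have mY : measurable ((A `+` C) `|` (A' `+` C')).
    by apply: measurableU; exact: measurableY.
  have mZ : measurable ((A `+` A') `|` ((A `+` C) `|` (A' `+` C'))).
    by apply: measurableU => //; exact: measurableY.
  have Yle : m ((A `+` C) `|` (A' `+` C')) <= m (A `+` C) + m (A' `+` C').
    by apply: fine_le_subU => //; exact: measurableY.
  have Zle : m ((A `+` A') `|` ((A `+` C) `|` (A' `+` C'))) <=
      m (A `+` A') + m ((A `+` C) `|` (A' `+` C')).
    by apply: fine_le_subU => //; exact: measurableY.
  have ACC1 : m A <= m (C `&` C') + m ((A `+` A') `|` ((A `+` C) `|` (A' `+` C'))).
    apply: fine_le_subU => // u Au.
    have [A'u|nA'u] := pselect (A' u); last by right; left; left.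
    have [Cu|nCu] := pselect (C u); last by right; right; left; left.
    have [C'u|nC'u] := pselect (C' u); last by right; right; right; left.
    by left.
  have ACC2 : m (C `&` C') <= m A + m (A `+` C).
    apply: fine_le_subU => //; first exact: measurableY.
    by move=> u [Cu _]; have [Au|nAu] := pselect (A u); [left|right; right].
  rewrite CC' in ACC1 ACC2; have := m0 C; have := m0 A; have := m1 A mA;
    have := m1 C mC.
  rewrite -/(m _) in ltC; rewrite mAA' shiftE in Zle Yle.
  by rewrite ler_norml => *; apply/andP; split; nra.
have {aa} /eqP : m A - m A ^+ 2 = 0.
  apply/eqP; rewrite -normr_le0; apply/ler_addgt0Pl => e e0; rewrite addr0.
  have := aa (e / 4) (divr_gt0 e0 (ltr0n _ 4)).
  by rewrite mulrCA divff ?mulr1 // pnatr_eq0.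
rewrite subr_eq0 expr2 => /eqP mAA.
have /eqP : m A * (1 - m A) = 0 by rewrite mulrBr mulr1 -mAA subrr.
rewrite mulf_eq0 => /orP[/eqP mA0|]; [left|rewrite subr_eq0 => /eqP mA1; right].
  by rewrite -(fineK finA) -/(m A) mA0.
by rewrite probability_setC // -(fineK finA) -/(m A) -mA1 subee.
Qed.

End shift_ergodic.

(** * Paths as products of increments *)

Section paths.
Context (G : groupType).
Implicit Types (g h : G) (u x : bipath G).

(** [u z] is the step from time z to time z+1 at negative times too, and [Negz i] is -(i+1); going
    backwards therefore multiplies by inverses. *)
Definition path_of g u : bipath G := fun z =>
  match z with
  | Posz n => (g * \prod_(0 <= i < n) u (Posz i))%g
  | Negz n => (g * \prod_(0 <= i < n.+1) (u (Negz i))^-1)%g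
  end.

Lemma path_of0 g u : path_of g u 0 = g.
Proof. by rewrite /path_of /= big_geq // mulg1. Qed.

Lemma path_ofS g u z : path_of g u (z + 1) = (path_of g u z * u z)%g.
Proof.
case: z => [n|[|n]].
- by rewrite -PoszD addn1 /= big_nat_recr //= mulgA.
- by rewrite (_ : Negz 0 + 1 = 0) // path_of0 /= big_nat1 mulgVK.
- have -> : Negz n.+1 + 1 = Negz n by lia.
  by rewrite /= [in RHS]big_nat_recr //= -!mulgA mulVg mulg1.
Qed.

(** Each transformation rule below is proved by comparing the position at time 0 and the
    increments. *)
Lemma path_of_unique g u x :
  x 0 = g -> (forall z, x (z + 1) = x z * u z)%g -> x = path_of g u.
Proof.
move=> x0 xS; apply/funext; case=> n.
  elim: n => [|n IHn]; first by rewrite path_of0.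
  by rewrite -addn1 PoszD xS path_ofS IHn.
elim: n => [|n IHn].
  have e := path_ofS g u (Negz 0); rewrite (_ : Negz 0 + 1 = 0) // path_of0 in e.
  have := xS (Negz 0); rewrite (_ : Negz 0 + 1 = 0) // x0 {1}e.
  by move=> /mulIg/esym.
have e : Negz n = Negz n.+1 + 1 by lia.
by move: IHn; rewrite e xS path_ofS => /mulIg.
Qed.

Lemma path_of_shift k g u :
  path_shift k (path_of g u) = path_of (path_of g u (- k)) (path_shift k u).
Proof.
apply: path_of_unique; first by rewrite /path_shift sub0r.
by move=> z; rewrite /path_shift addrAC path_ofS.
Qed.

Lemma path_ofD g u (n : int) z :
  path_of g u (z + n) = path_of (path_of g u n) (path_shift (- n) u) z.
Proof.
by have := path_of_shift (- n) g u; rewrite opprK => <-; rewrite /path_shift opprK.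
Qed.

Lemma path_of_translate h g u : translate h (path_of g u) = path_of (h * g)%g u.
Proof.
apply: path_of_unique; first by rewrite /translate path_of0.
by move=> z; rewrite /translate path_ofS mulgA.
Qed.

Lemma path_of_reverse g u z :
  path_of g (reverse_increments u) z = path_of g u (- z).
Proof.
apply/esym; move: z; apply/funeqP/path_of_unique; first by rewrite oppr0 path_of0.
move=> z; rewrite /reverse_increments.
have e := path_ofS g u (- z - 1); rewrite subrK in e.
by rewrite e (_ : - (z + 1) = - z - 1) ?mulgK //; lia.
Qed.

(** Rebasing at the identity cancels the starting point of the shifted path, so [tau] becomes the
    Bernoulli shift on increments. *)
Lemma tau_path_of k u : tau k (path_of 1%g u) = path_of 1%g (path_shift k u).
Proof.
apply: path_of_unique; first by rewrite /tau sub0r mulVg.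
by move=> z; rewrite /tau addrAC path_ofS mulgA.
Qed.

Lemma path_of_increments x : exists u, x = path_of (x 0) u.
Proof.
exists (fun z => (x z)^-1 * x (z + 1))%g; apply: path_of_unique => // z.
by rewrite mulgA mulgV mul1g.
Qed.

Lemma path_of_agree g u v (n : nat) :
  (forall i : nat, (i < n)%N -> u (Posz i) = v (Posz i)) ->
  forall m : nat, (m <= n)%N -> path_of g u (Posz m) = path_of g v (Posz m).
Proof.
move=> uv m mn; congr (_ * _)%g; apply: eq_big_nat => i /andP[_ im].
by apply: uv; exact: leq_trans im mn.
Qed.

Hypothesis cG : countable [set: G].

Lemma G_random_variable_path_of g z : G_random_variable (fun u => path_of g u z).
Proof.
case: z => n; apply: (G_random_variable_comp (fun h => g * h)%g);
  apply: (G_random_variable_prod cG) => i.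
  exact: G_random_variable_coord.
by apply: (G_random_variable_comp (fun h => h^-1)%g); exact: G_random_variable_coord.
Qed.

Lemma measurable_path_of g : measurable_fun setT (path_of g).
Proof. by apply: G_random_variable_bipath => z; exact: G_random_variable_path_of. Qed.

End paths.

Arguments path_of {G} g u z : simpl never.

(** * Transience *)

Section hitting.
Context (G : groupType).
Implicit Types (g y : G) (u v : bipath G) (n m : nat).

Definition at_time g n y : set (bipath G) := [set u | path_of g u (Posz n) = y].

Definition hits y : set (bipath G) := \bigcup_n at_time y n 1%g.

Definition no_return : set (bipath G) :=
  [set u | forall n, path_of 1%g u (Posz n.+1) <> 1%g].

(** The increments in [past n] determine the positions up to time n relative to the start; those in
    [future n] are the steps taken from time n on. *)
Definition past n : {pred int} := [pred z : int | (0 <= z) && (z < n%:Z)].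
Definition future n : {pred int} := [pred z : int | n%:Z <= z].

Lemma past_agree g n u v : {in past n, u =1 v} ->
  forall m, (m <= n)%N -> path_of g u (Posz m) = path_of g v (Posz m).
Proof.
by move=> uv; apply: path_of_agree => i lt_in; apply: uv; rewrite inE /=; lia.
Qed.

Lemma determined_at_time g n y : determined (past n) (at_time g n y).
Proof. by move=> u v uv; rewrite /at_time /= -(past_agree g uv). Qed.

Lemma future_agree g u v : {in future 0, u =1 v} ->
  forall m, path_of g u (Posz m) = path_of g v (Posz m).
Proof. by move=> uv m; apply: (@past_agree g m u v) => // z /andP[z0 _];
  exact: uv. Qed.

Lemma determined_hits y : determined (future 0) (hits y).
Proof.
by move=> u v uv [n _ hn]; exists n => //; rewrite /at_time /= -(future_agree _ uv).
Qed.

Lemma determined_no_return : determined (future 0) no_return.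
Proof. by move=> u v uv nr n; rewrite -(future_agree _ uv). Qed.

Lemma path_of_addn g u n m :
  path_of g u (Posz (m + n)) =
  path_of (path_of g u (Posz n)) (path_shift (- n%:Z) u) (Posz m).
Proof. by rewrite PoszD path_ofD. Qed.

Hypothesis cG : countable [set: G].

Lemma measurable_at_time g n y : measurable (at_time g n y).
Proof. exact: (G_random_variable_path_of cG g (Posz n) [set y]). Qed.

Lemma measurable_hits y : measurable (hits y).
Proof. by apply: bigcup_measurable => n _; exact: measurable_at_time. Qed.

Lemma measurable_no_return : measurable no_return.
Proof.
rewrite (_ : no_return = \bigcap_n ~` at_time 1%g n.+1 1%g).
  by apply: bigcapT_measurable => n; apply: measurableC; exact: measurable_at_time.
by apply/seteqP; split => [u nr n _|u nr n] /=; [exact: nr|exact: nr n I].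
Qed.

Context (R : realType) (nu : probability (bipath G) R).

(** This is F(y,o); minus its logarithm is the Green distance from y to o. *)
Definition hit_prob y : R := fine (nu (hits y)).

Lemma hit_prob_le1 y : hit_prob y <= 1.
Proof.
rewrite -[1]/(fine 1%E) fine_le ?fin_num_measure //; first exact: measurable_hits.
by apply: probability_le1; exact: measurable_hits.
Qed.

End hitting.

Section transience.
Local Open Scope ereal_scope.
Context (R : realType) (G : groupType) (mu : G -> R).
Hypothesis hmu : prob_mass mu.
Hypothesis sym_mu : forall g, mu (g^-1)%g = mu g.
Context (nu : probability (bipath G) R).
Hypothesis iid_nu : iid nu mu (fun z (u : bipath G) => u z).
Implicit Types (g y : G) (u v : bipath G) (n m : nat).

Let measurable_preshift k B : measurable B -> measurable (@path_shift G k @^-1` B).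
Proof. exact: preimage_measurable (@measurable_shift G k). Qed.

(** Shifting by -n brings the steps taken from time n on to time 0. They are independent of the
    first n steps, and the shift preserves [nu]. *)
Lemma markov_property n B C : measurable B -> measurable C ->
  determined (past n) B -> determined (future 0) C ->
  nu (B `&` path_shift (- n%:Z) @^-1` C) = nu B * nu C.
Proof.
move=> mB mC detB detC; rewrite -[in RHS](shift_invariant sym_mu iid_nu (- n%:Z) mC).
apply: (@determined_indep _ _ _ hmu _ iid_nu (past n) (future n)) => //.
- by move=> z; rewrite !inE /=; lia.
- exact: measurable_preshift.
- move=> u v uv; apply: detC => z z0; rewrite /path_shift; apply: uv.
  by rewrite !inE /= in z0 *; lia.
Qed.

Hypothesis cG : countable [set: G].
Hypothesis reach : forall y, exists n, nu (at_time 1%g n y) != 0.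

(** A path from the identity to the inverse of y becomes, after translation by y, a path from y to
    the identity. *)
Lemma hit_prob_gt0 y : (0 < hit_prob nu y)%R.
Proof.
have [n nz] := reach (y^-1)%g.
have mh := measurable_hits cG y.
rewrite fine_gt0 //; apply/andP; split; last by rewrite ltey_eq fin_num_measure.
rewrite lt0e measure_ge0 andbT; apply: contra_neq nz => h0.
apply: subset_measure0 h0 => //; first exact: measurable_at_time.
move=> u hu; exists n => //; rewrite /at_time /= in hu *.
by rewrite -[y]mulg1 -path_of_translate /translate hu mulgV.
Qed.

(** By contraposition: if returning to the identity is almost sure, then so is returning after every
    time n. Since y is reached with positive probability at some time n, the walk from y must then
    hit the identity almost surely. *)
Lemma no_return_pos y : (hit_prob nu y < 1)%R -> nu (@no_return G) != 0.
Proof.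
apply: contraTneq => r0; rewrite -leNgt.
pose E n := \bigcup_(m in [set m | (n <= m)%N]) at_time (1%g : G) m 1%g.
have mE n : measurable (E n).
  by apply: bigcup_measurable => m _; exact: measurable_at_time.
have E0 n : nu (~` E n) = 0.
  (* If there is no visit after time n, there is a last visit, at some time m, and the path seen
     from time m never returns. *)
  pose F m := path_shift (- m%:Z) @^-1` @no_return G.
  have mF m : measurable (F m) by exact: measurable_preshift (measurable_no_return cG).
  have F0 : nu (\bigcup_m F m) = 0.
    apply: measure_countable_bigcup0 => // m.
    exact: etrans (shift_invariant sym_mu iid_nu _ (measurable_no_return cG)) r0.
  apply: (@subset_measure0 _ _ _ nu _ (\bigcup_m F m)) => //.
  - exact: measurableC.
  - exact: bigcup_measurable.
  move=> u nE.
  (* k is the time of the last visit to the identity *)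
  have exP : exists m, path_of 1%g u (Posz m) == 1%g by exists 0%N; rewrite path_of0.
  have [|k /eqP uk maxk] := ex_maxnP exP (m := n).
    move=> m /eqP um; rewrite leqNgt; apply/negP => lt_nm; apply: nE.
    by exists m => //; exact: ltnW.
  exists k => // m; rewrite -{1}uk => um.
  by have /maxk : path_of 1%g u (Posz (m.+1 + k)) == 1%g;
    [rewrite path_of_addn um|rewrite addSn ltnNge leq_addl].
have [n nz] := reach y.
have := markov_property (measurable_at_time cG 1%g n y)
  (measurableC (measurable_hits cG y)) (@determined_at_time _ 1%g n y).
have detC : determined (future 0) (~` hits y).
  by move=> u v uv nh hv; apply: nh; apply: determined_hits hv => z zf; rewrite uv.
move=> /(_ detC).
(* A path that is at y at time n and misses the identity from then on lies outside [E n]. *)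
rewrite [LHS](_ : _ = 0); last first.
  apply: (subset_measure0 _ _ _ (E0 n)).
  - apply: measurableI; first exact: measurable_at_time.
    exact: measurable_preshift (measurableC (measurable_hits cG y)).
  - exact: measurableC.
  move=> u [un nh] [m /= le_nm um]; apply: nh; exists (m - n)%N => //.
  by rewrite /at_time /= -{1}un -path_of_addn subnK.
move=> /esym/eqP; rewrite mule_eq0 (negPf nz) /= => /eqP.
rewrite probability_setC; last exact: measurable_hits.
have fh : nu (hits y) \is a fin_num.
  by apply: fin_num_measure; exact: measurable_hits.
by move/eqP; rewrite sube_eq ?add0e // => /eqP e1; rewrite /hit_prob -e1.
Qed.

Hypothesis transient : nu (@no_return G) != 0.

(** The events of a last visit at time n are disjoint and have probability [nu (at_time g n 1)]
    times the escape probability. So the expected number of visits is finite, and Borel-Cantelli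
    applies. *)
Lemma finitely_many_visits g : nu (lim_sup_set (fun n => at_time g n 1%g)) = 0.
Proof.
apply: lim_sup_set_cvg0; first by move=> n; exact: measurable_at_time.
pose F n := at_time g n 1%g `&` path_shift (- n%:Z) @^-1` @no_return G.
have mF n : measurable (F n).
  apply: measurableI; first exact: measurable_at_time.
  exact: measurable_preshift (measurable_no_return cG).
have FE n : nu (F n) = nu (at_time g n 1%g) * nu (@no_return G).
  apply: markov_property.
  - exact: measurable_at_time.
  - exact: measurable_no_return.
  - exact: determined_at_time.
  - exact: determined_no_return.
have tF : trivIset setT F.
  have aux i j u : (i < j)%N -> F i u -> ~ F j u.
    move=> ij [ui nr] [uj _]; apply: (nr (j - i.+1)%N).
    by rewrite -[in LHS]ui -path_of_addn -[RHS]uj; congr (path_of _ _ (Posz _)); lia.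
  move=> i j _ _ [u [Fi Fj]]; apply/eqP; rewrite eqn_leq; apply/andP.
  by split; rewrite leqNgt; apply/negP => lt;
    [exact: aux lt Fj Fi|exact: aux lt Fi Fj].
have mU : measurable (\bigcup_n F n) by exact: bigcup_measurable.
have finr : nu (@no_return G) \is a fin_num.
  by apply: fin_num_measure; exact: measurable_no_return.
have r0 : (0 < fine (nu (@no_return G)))%R.
  rewrite fine_gt0 // lt0e transient measure_ge0 /=.
  by rewrite ltey_eq finr.
have le1 : (fine (nu (@no_return G)))%:E * \sum_(n <oo) nu (at_time g n 1%g) <= 1.
  rewrite -nneseriesZl //; apply: le_trans (probability_le1 nu mU).
  rewrite measure_semi_bigcup //; apply: lee_nneseries => [n _ _|n _].
    by rewrite mule_ge0 ?lee_fin ?measure_ge0 // ltW.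
  by rewrite fineK // muleC le_eqVlt; apply/orP; left; apply/eqP; exact: esym (FE n).
rewrite ltNge; apply/negP; rewrite leye_eq => /eqP soo.
by move: le1; rewrite soo gt0_muley ?lte_fin // leye_eq.
Qed.

(** At the first time after [N] when the hitting probability is at least e, the Markov property
    gives a chance of at least e to visit the identity later, hence after time [N]. *)
Lemma hit_prob_maximal g N (e : R) : (0 <= e)%R ->
  e%:E * nu [set u | exists2 n, (N <= n)%N & (e
    <= hit_prob nu (path_of g u (Posz n)))%R]
  <= nu (\bigcup_(n in [set n | (N <= n)%N]) at_time g n 1%g).
Proof.
move=> e0.
set Q := [set u | _]; set E := \bigcup_(n in _) _.
pose high y := (e <= hit_prob nu y)%R.
(* first time after N, and position, at which the hitting probability is at least e *)
pose D (ny : nat * G) : set (bipath G) := at_time g ny.1 ny.2 `&`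
  [set u | [/\ (N <= ny.1)%N, high ny.2 &
     forall m, (N <= m < ny.1)%N -> ~~ high (path_of g u (Posz m))]].
have mhigh n : measurable [set u | high (path_of g u (Posz n))].
  exact: (G_random_variable_path_of cG g (Posz n) high).
have mE : measurable E.
  by apply: bigcup_measurable => n _; exact: measurable_at_time.
have mD ny : measurable (D ny).
  apply: measurableI; first exact: measurable_at_time.
  have [[h1 h2]|nh] := pselect ((N <= ny.1)%N /\ high ny.2); last first.
    by rewrite (_ : [set _ | _] = set0) // -subset0 => u [h1 h2 _]; apply: nh.
  rewrite (_ : [set _ | _] = \bigcap_(m in [set m | (N <= m < ny.1)%N])
      ~` [set u | high (path_of g u (Posz m))]).
    by apply: bigcap_measurableType => m _; exact: measurableC.
  apply/seteqP; split => [u [_ _ h3] m /= mN|u h3]; first exact/negP/h3.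
  by split => // m mN; apply/negP/h3.
have detD ny : determined (past ny.1) (D ny).
  move=> u v uv [un [h1 h2 h3]]; split; first exact: determined_at_time uv un.
  split => // m mN; rewrite -(past_agree g uv); first exact: h3.
  by case/andP: mN => _ /ltnW.
have tD : trivIset setT D.
  have aux i j u : D i u -> D j u -> (i.1 <= j.1)%N.
    move=> [ui [i1 i2 i3]] [uj [j1 j2 j3]]; rewrite leqNgt; apply/negP => lt.
    by have := i3 j.1; rewrite j1 lt uj j2 => /(_ isT).
  move=> i j _ _ [u [Di Dj]].
  have eij : i.1 = j.1 by apply/eqP; rewrite eqn_leq (aux i j u) // (aux j i u).
  case: Di Dj => ui _ [uj _]; rewrite (surjective_pairing i) (surjective_pairing j).
  by rewrite -ui -uj eij.
have QD : Q `<=` \bigcup_ny D ny.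
  move=> u [n Nn hn].
  have exP : exists n, (N <= n)%N && high (path_of g u (Posz n)) by exists n;
    rewrite Nn.
  have [k /andP[Nk hk] mink] := ex_minnP exP.
  exists (k, path_of g u (Posz k)) => //; split => //; split => // m /andP[Nm mk].
  apply/negP => hm; have := mink m; rewrite Nm hm => /(_ isT).
  by rewrite leqNgt mk.
have mQ : measurable Q.
  rewrite (_ : Q = \bigcup_(n in [set n | (N <= n)%N])
    [set u | high (path_of g u (Posz n))]).
    by apply: bigcup_measurable => n _; exact: mhigh.
  by apply/seteqP; split => u [n]; exists n.
apply: (ge_measure_partition (D := D)) => //.
  by rewrite -setXTT; apply: countableX.
move=> [n y].
have [hy|nhy] := boolP ((N <= n)%N && high y); last first.
  rewrite (_ : Q `&` _ = set0) ?measure0 ?mule0 ?measure_ge0 //.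
  by rewrite -subset0 => u [_ [_ /= [h1 h2 _]]]; move: nhy; rewrite h1 h2.
case/andP: hy => Nn hy.
have hE : D (n, y) `&` path_shift (- n%:Z) @^-1` hits y `<=` E `&` D (n, y).
  move=> u [Du [m _ um]]; split => //; exists (m + n)%N; first by rewrite /= ; lia.
  by rewrite /at_time /= path_of_addn (Du.1).
have mh := measurable_hits cG y.
apply: (@le_trans _ _ (nu (D (n, y) `&` path_shift (- n%:Z) @^-1` hits y)));
  last first.
  rewrite le_measure ?inE //; apply: measurableI => //.
  exact: measurable_preshift.
rewrite (markov_property (mD (n, y)) mh (detD (n, y)) (@determined_hits _ y)).
rewrite muleC; apply: lee_pmul => //.
- by rewrite le_measure ?inE //; exact: measurableI.
- by rewrite -(fineK (fin_num_measure nu _ mh)) lee_fin.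
Qed.

(** As N grows, the right side of the maximal inequality tends to the probability of infinitely many
    visits, which is 0. The thresholds 1/(k+1) keep the union countable. *)
Lemma hit_prob_vanishes_forward g :
  nu [set u | exists k, forall N, exists2 n, (N <= n)%N &
        (k.+1%:R^-1 <= hit_prob nu (path_of g u (Posz n)))%R] = 0.
Proof.
pose Q (e : R) N := [set u | exists2 n, (N <= n)%N &
   (e <= hit_prob nu (path_of g u (Posz n)))%R].
have mQ e N : measurable (Q e N).
  rewrite (_ : Q e N = \bigcup_(n in [set n | (N <= n)%N])
     [set u | (e <= hit_prob nu (path_of g u (Posz n)))%R]).
    apply: bigcup_measurable => n _.
    exact: (G_random_variable_path_of cG g (Posz n) [set y | (e <= hit_prob nu y)%R]).
  by apply/seteqP; split => u [n]; exists n.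
rewrite (_ : [set _ | _] = \bigcup_k \bigcap_N Q k.+1%:R^-1%R N); last first.
  apply/seteqP; split => [u [k h]|u [k _ h]]; exists k => // N; last exact: h.
  by move=> _; exact: h.
apply: measure_countable_bigcup0 => // k; first exact: bigcapT_measurable.
set e : R := (k.+1%:R^-1)%R; have e0 : (0 < e)%R by rewrite invr_gt0.
have mI : measurable (\bigcap_N Q e N) by exact: bigcapT_measurable.
have bound N : e%:E * nu (\bigcap_N Q e N) <=
    nu (\bigcup_(n in [set n | (N <= n)%N]) at_time g n 1%g).
  apply: le_trans (hit_prob_maximal g N (ltW e0)).
  rewrite lee_pmul2l ?lte_fin // le_measure ?inE //; first exact: (mQ e N).
  by move=> u /(_ N I).
have cv0 : (fun N => nu (\bigcup_(n in [set n | (N <= n)%N]) at_time g n 1%g)) @ \oo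
    --> (0 : \bar R).
  rewrite -(finitely_many_visits g); apply: lim_sup_set_cvg.
    by move=> n; exact: measurable_at_time.
  rewrite ltey_eq fin_num_measure //; apply: bigcup_measurable => n _.
  exact: measurable_at_time.
have : e%:E * nu (\bigcap_N Q e N) <= 0.
  rewrite -(cvg_lim _ cv0) //; apply: lime_ge; first by apply/cvg_ex; eexists;
    exact: cv0.
  by apply: nearW.
rewrite pmule_rle0 ?lte_fin // => le0.
by apply/eqP; rewrite eq_le le0 measure_ge0.
Qed.

(** The backward end of a path is the forward end of its reversal, and reversal of increments
    preserves [nu]. *)
Lemma hit_prob_vanishes g : exists2 Z : set (bipath G),
  measurable Z /\ nu Z = 0 & forall u, ~ Z u -> forall e : R, (0 < e)%R ->
    exists N : nat, forall z : int, (N <= absz z)%N ->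
      (hit_prob nu (path_of g u z) < e)%R.
Proof.
pose B := [set u | exists k, forall N, exists2 n, (N <= n)%N &
        (k.+1%:R^-1 <= hit_prob nu (path_of g u (Posz n)))%R].
have B0 : nu B = 0 := hit_prob_vanishes_forward g.
have mB : measurable B.
  rewrite (_ : B = \bigcup_k \bigcap_N \bigcup_(n in [set n | (N <= n)%N])
     [set u | (k.+1%:R^-1 <= hit_prob nu (path_of g u (Posz n)))%R]).
    apply: bigcup_measurable => k _; apply: bigcapT_measurable => N.
    apply: bigcup_measurable => n _.
    exact: (G_random_variable_path_of cG g (Posz n) [set y | 
      (k.+1%:R^-1 <= hit_prob nu y)%R]).
  apply/seteqP; split => [u [k h]|u [k _ h]]; exists k => // N.
    by move=> _; have [n] := h N; exists n.
  by have [n] := h N I; exists n.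
have mrB : measurable (@reverse_increments G @^-1` B).
  exact: preimage_measurable (@measurable_reverse G) mB.
exists (B `|` @reverse_increments G @^-1` B).
  split; first exact: measurableU.
  rewrite null_set_setU //; exact: etrans (reverse_invariant sym_mu iid_nu mB) B0.
have notB u : ~ B u -> forall e : R, (0 < e)%R -> exists N, forall n, (N <= n)%N ->
    (hit_prob nu (path_of g u (Posz n)) < e)%R.
  (* This choice of k ensures 1/(k+1) < e. *)
  move=> nB e e0; pose k := Num.truncn e^-1.
  have ke : (k.+1%:R^-1 < e)%R.
    by rewrite invf_plt ?posrE // truncnS_gt.
  apply: contrapT => nN; apply: nB; exists k => N; apply: contrapT => nn; apply: nN.
  exists N => n Nn; rewrite (le_lt_trans _ ke) // leNgt; apply/negP => lt.
  by apply: nn; exists n => //; exact: ltW.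
move=> u nZ e e0.
have [N hN] : exists N, forall n, (N
  <= n)%N -> (hit_prob nu (path_of g u (Posz n)) < e)%R.
  by apply: notB => // Bu; apply: nZ; left.
have [N' hN'] : exists N, forall n, (N <= n)%N ->
    (hit_prob nu (path_of g u (- Posz n)%R) < e)%R.
  have [|M hM] := notB (reverse_increments u) _ e e0; first by move=> Bu;
    apply: nZ; right.
  by exists M => n /hM; rewrite path_of_reverse.
exists (maxn N N') => z; rewrite geq_max => /andP[Nz N'z].
have [z0|z0] := leP 0%R z.
  by rewrite -(gez0_abs z0); exact: hN.
by have := hN' _ N'z; rewrite ltz0_abs // opprK.
Qed.

End transience.

(** * The two quotient actions *)

Section path_space_actions.
Context (G : groupType).
Hypothesis cG : countable [set: G].
Implicit Types (g h : G) (x u : bipath G) (k : int) (B : set (bipath G)).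

Lemma measurable_translate h : measurable_fun setT (@translate G h).
Proof.
by apply: G_random_variable_bipath => z;
  apply: (G_random_variable_comp (fun g => h * g)%g); exact: G_random_variable_coord.
Qed.

Lemma measurable_tau k : measurable_fun setT (@tau G k).
Proof.
by apply: G_random_variable_bipath => z;
  apply: (G_random_variable_comp2 cG (fun g h => g^-1 * h)%g);
    exact: G_random_variable_coord.
Qed.

Lemma measurable_based_paths : measurable (@based_paths G).
Proof. exact: (@G_random_variable_coord G 0 [set 1%g]). Qed.

Lemma path_shiftD k l x : path_shift k (path_shift l x) = path_shift (k + l) x.
Proof. by apply/funext => z; rewrite /path_shift opprD addrA. Qed.

Lemma path_shift0 x : path_shift 0 x = x.
Proof. by apply/funext => z; rewrite /path_shift subr0. Qed.

Lemma translateM g h x : translate g (translate h x) = translate (g * h)%g x.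
Proof. by apply/funext => z; rewrite /translate mulgA. Qed.

Lemma translate1 x : translate 1%g x = x.
Proof. by apply/funext => z; rewrite /translate mul1g. Qed.

Context (R : realType) (dG : G -> G -> R).
Notation D := (fundamental_domain dG).

Lemma measurable_fundamental_domain : measurable D.
Proof.
rewrite (_ : D = ~` (\bigcup_(z in [set: int]) [set x : bipath G | ~
    ((z < 0 -> dG (x 0) 1%g < dG (x z) 1%g) /\
     (0 < z -> dG (x 0) 1%g <= dG (x z) 1%g))])).
  apply: measurableC; apply: countable_bigcupT_measurable => // z.
  apply: (G_random_variable_rel cG (fun g h => ~ ((z < 0 -> dG g 1%g < dG h 1%g) /\
     (0 < z -> dG g 1%g <= dG h 1%g)))); exact: G_random_variable_coord.
apply/seteqP; split => [x [neg pos] [z _]|x nx].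
  by apply; split; [exact: neg|exact: pos].
by split => z; apply: contrapT => nz; apply: nx; exists z => // -[neg pos]; exact: nz.
Qed.

(** Time 0 is the first time at which the distance to the identity is minimal: the inequality is
    strict before it and weak after it, so two such times in one orbit contradict each other. *)
Lemma fundamental_domain_unique k x : D x -> D (path_shift k x) -> k = 0.
Proof.
move=> [neg pos] [neg' pos']; have [k0|k0|//] := ltrgtP k 0.
- have := neg' k k0; rewrite /path_shift subrr sub0r => lt.
  by have := pos (- k); rewrite oppr_gt0 => /(_ k0); rewrite leNgt lt.
- have := pos' k k0; rewrite /path_shift subrr sub0r => le.
  by have := neg (- k); rewrite oppr_lt0 => /(_ k0); rewrite ltNge le.
Qed.

Lemma domain_actionE g k x : D (path_shift k (translate g x)) ->
  domain_action dG g x = path_shift k (translate g x).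
Proof.
move=> Dk; apply: xget_subset1; first by split => //; exists k.
move=> x1 x2 [D1 [k1 e1]] [D2 [k2 e2]]; move: D1 D2; rewrite e1 e2 => D1 D2.
suff /eqP : k1 - k2 = 0 by rewrite subr_eq0 => /eqP ->.
by apply: (fundamental_domain_unique D2); rewrite path_shiftD subrK.
Qed.

End path_space_actions.

Section ergodic_actions.
Local Open Scope ereal_scope.
Context (R : realType) (G : groupType) (mu : G -> R).
Hypothesis cG : countable [set: G].
Hypothesis hmu : prob_mass mu.
Hypothesis sym_mu : forall g, mu (g^-1)%g = mu g.
Context (nu : probability (bipath G) R).
Hypothesis iid_nu : iid nu mu (fun z (u : bipath G) => u z).
Context (plaw : G -> set (bipath G) -> \bar R).
Hypothesis plawE : forall g B, measurable B -> plaw g B = nu (path_of g @^-1` B).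
Implicit Types (g h : G) (x u : bipath G) (k : int) (B : set (bipath G)).

Let mpath g B : measurable B -> measurable (path_of g @^-1` B).
Proof. exact: preimage_measurable (measurable_path_of cG g). Qed.

Let mshift k B : measurable B -> measurable (@path_shift G k @^-1` B).
Proof. exact: preimage_measurable (@measurable_shift G k). Qed.

Let mtrans h B : measurable B -> measurable (@translate G h @^-1` B).
Proof. exact: preimage_measurable (@measurable_translate G h). Qed.

Let mtau k B : measurable B -> measurable (@tau G k @^-1` B).
Proof. exact: preimage_measurable (measurable_tau cG k). Qed.

Lemma tau_law k B : measurable B -> plaw 1%g (tau k @^-1` B) = plaw 1%g B.
Proof.
move=> mB; rewrite (plawE _ mB) (plawE _ (mtau k mB)).
rewrite -(shift_invariant sym_mu iid_nu k (mpath 1%g mB)); congr (nu _).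
by apply/seteqP; split => u /=; rewrite tau_path_of.
Qed.

(** On based paths, [path_of 1] conjugates [tau] to the Bernoulli shift, whose ergodicity is
    transported. *)
Lemma tau_ergodic : ergodic (@based_paths G) (@tau G) (plaw 1%g).
Proof.
split.
  (* The maps [tau k] are invertible only on based paths, since [tau] forgets the starting point. *)
  have tauK k : forall x, based_paths x -> tau k (tau (- k) x) = x.
    move=> x x0; have [u ->] := path_of_increments x.
    by rewrite x0 !tau_path_of path_shiftD subrr path_shift0.
  move=> k A mA Ab; split => [[B [mB B0 AB]]|[B [mB B0 AB]]].
    exists (tau (- k) @^-1` B); split; [exact: mtau|by rewrite tau_law|].
    move=> x Ax; apply: AB; have xb := Ab x Ax; split; last by rewrite /= tauK.
    by rewrite /based_paths /tau /= sub0r mulVg.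
  exists (tau k @^-1` B); split; [exact: mtau|by rewrite tau_law|].
  by move=> x [_ /AB].
move=> A mA Ab inv.
have based u : based_paths (path_of (1%g : G) u) by rewrite /based_paths /= path_of0.
have nuE k :
    nu (path_of 1%g @^-1` A `+` path_shift k @^-1` (path_of 1%g @^-1` A)) = 0.
  have [B [mB + AB]] := inv k; rewrite (plawE _ mB) => B0.
  apply: subset_measure0 B0.
  - by apply: measurableY; [exact: mpath|apply: mshift; exact: mpath].
  - exact: mpath.
  move=> u; rewrite /setY /setD /= -tau_path_of => ku; apply: AB.
  case: ku => -[h1 h2]; [left; split => // |right; split => //].
  by case=> _ /h2.
have [A0|A0] := shift_ergodic hmu sym_mu iid_nu (mpath 1%g mA) nuE.
  by left; rewrite plawE.
right; rewrite plawE; last by apply: measurableD => //; exact: measurable_based_paths.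
by rewrite -A0; congr (nu _); apply/seteqP; split => [u [_]//|u nA]; split.
Qed.

(** For measurable sets, being null for the sum over all starting points means being null for each
    of them. *)
Definition null_paths B := measurable B /\ forall g, nu (path_of g @^-1` B) = 0.

Lemma esum_plaw_null B : measurable B ->
  \esum_(g in [set: G]) plaw g B = 0 <-> null_paths B.
Proof.
move=> mB; split => [e0|[_ B0]]; last by apply: esum1 => g _; rewrite plawE.
split => // g; apply/eqP; rewrite eq_le measure_ge0 andbT -e0 -plawE //.
apply: esum_ge; exists [set g]; first by split => //; exact: finite_set1.
by rewrite fsbig_set1.
Qed.

Lemma null_pathsS B B' : measurable B -> B `<=` B' -> null_paths B' -> null_paths B.
Proof.
move=> mB BB' [mB' B'0]; split => // g.
by apply: subset_measure0 (B'0 g); [exact: mpath|exact: mpath|move=> u; exact: BB'].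
Qed.

Lemma null_paths_bigcup (I : Type) (F : I -> set (bipath G)) :
  countable [set: I] -> (forall i, null_paths (F i)) -> null_paths (\bigcup_i F i).
Proof.
move=> cI F0; split.
  by apply: countable_bigcupT_measurable => // i; case: (F0 i).
move=> g; rewrite preimage_bigcup; apply: measure_countable_bigcup0 => // i.
  by apply: mpath; case: (F0 i).
exact: (proj2 (F0 i) g).
Qed.

Lemma null_pathsU B B' : null_paths B -> null_paths B' -> null_paths (B `|` B').
Proof.
move=> [mB B0] [mB' B'0]; split; first exact: measurableU.
move=> g; apply: null_set_setU; [exact: mpath|exact: mpath|exact: B0|exact: B'0].
Qed.

Lemma null_paths_translate h B : null_paths B -> null_paths (translate h @^-1` B).
Proof.
move=> [mB B0]; split; first exact: mtrans.
move=> g; rewrite -(B0 (h * g)%g); congr (nu _).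
by apply/seteqP; split => u /=; rewrite path_of_translate.
Qed.

(** The shifted path starts at a random point, so the null sets for all starting points h are united
    first. *)
Lemma null_paths_shift k B : null_paths B -> null_paths (path_shift k @^-1` B).
Proof.
move=> [mB B0]; split; first exact: mshift.
have F0 : nu (\bigcup_h path_shift k @^-1` (path_of h @^-1` B)) = 0.
  apply: measure_countable_bigcup0 => // h; first by apply: mshift; exact: mpath.
  exact: etrans (shift_invariant sym_mu iid_nu k (mpath h mB)) (B0 h).
move=> g; apply: subset_measure0 F0.
- by apply: mpath; exact: mshift.
- by apply: countable_bigcupT_measurable => // h; apply: mshift; exact: mpath.
- by move=> u /=; rewrite path_of_shift => Bu; exists (path_of g u (- k)%R).
Qed.

Definition saturation B : set (bipath G) := \bigcup_k path_shift k @^-1` B.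

Lemma measurable_saturation B : measurable B -> measurable (saturation B).
Proof. by move=> mB; apply: countable_bigcupT_measurable => // k; exact: mshift. Qed.

Lemma null_saturation B : null_paths B -> null_paths (saturation B).
Proof. by move=> B0; apply: null_paths_bigcup => // k; exact: null_paths_shift. Qed.

(** Invariance under [G] removes the dependence on the starting point; what remains is an invariant
    event of the Bernoulli shift. *)
Lemma invariant_paths_null_or_conull B : measurable B ->
  (forall h x, B x -> B (translate h x)) -> (forall k x, B x -> B (path_shift k x)) ->
  null_paths B \/ null_paths (~` B).
Proof.
move=> mB Btrans Bshift.
have transE h x : B (translate h x) = B x.
  apply/propext; split => [|]; last exact: Btrans.
  by move/(Btrans (h^-1)%g); rewrite translateM mulVg translate1.
have pathE g u : B (path_of g u) = B (path_of 1%g u).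
  by rewrite -{1}[g]mulg1 -path_of_translate transE.
have inv k :
    nu (path_of 1%g @^-1` B `+` path_shift k @^-1` (path_of 1%g @^-1` B)) = 0.
  suff shiftE u : B (path_of 1%g (path_shift k u)) = B (path_of 1%g u).
    rewrite (_ : _ `+` _ = set0) ?measure0 // -subset0 => u [] [] /=;
      rewrite shiftE //.
  rewrite -(pathE (path_of 1%g u (- k)%R)) -path_of_shift.
  apply/propext; split => [|]; last exact: Bshift.
  by move/(Bshift (- k)%R); rewrite path_shiftD addNr path_shift0.
have [B0|B0] := shift_ergodic hmu sym_mu iid_nu (mpath 1%g mB) inv; [left|right].
  by split => // g; rewrite -B0; congr (nu _); apply/seteqP; split => u /=;
    rewrite pathE.
split; first exact: measurableC.
by move=> g; rewrite -B0; congr (nu _); apply/seteqP; split => u /=; rewrite pathE.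
Qed.

Context (dG : G -> G -> R).
Notation D := (fundamental_domain dG).

Let qlaw B : \bar R := \esum_(g in [set: G]) plaw g (B `&` D).

Let mD : measurable D := measurable_fundamental_domain cG dG.

Let qlaw_negligibleP N : N `<=` D ->
  qlaw.-negligible N <-> exists2 B, null_paths B & N `<=` B.
Proof.
move=> ND; split => [[B [mB B0 NB]]|[B B0 NB]].
  exists (B `&` D); first by apply/esum_plaw_null => //; exact: measurableI.
  by move=> x Nx; split; [exact: NB|exact: ND].
have mB := proj1 B0; exists B; split => //; apply/esum_plaw_null;
  first exact: measurableI.
by apply: null_pathsS B0; [exact: measurableI|move=> x []].
Qed.

Lemma domain_action_ergodic_empty : D = set0 -> ergodic D (domain_action dG) qlaw.
Proof.
move=> D0; have null0 : null_paths set0.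
  by split => // g; rewrite preimage_set0 measure0.
split => [g A mA AD|A mA AD _].
  have A0 : A = set0 by rewrite -subset0 -D0.
  by split => _; apply/qlaw_negligibleP => //; exists set0 => // x;
    rewrite ?D0 ?A0 // => -[].
by left; apply/esum_plaw_null; [exact: measurableI|rewrite D0 setI0].
Qed.

Hypothesis orbit_meets_D : null_paths (~` saturation D).

Let outside h : null_paths (translate h @^-1` (~` saturation D)).
Proof. exact: null_paths_translate. Qed.

Lemma domain_action_ergodic : ergodic D (domain_action dG) qlaw.
Proof.
split => [g A mA AD|A mA AD inv].
  split => /qlaw_negligibleP[].
  - by move=> x [].
  - move=> B B0 sub; apply/qlaw_negligibleP => //.
    (* The translated orbit of y either misses the domain, which is null, or meets it at a point
       that the action of g sends to y; that point lies in [B]. *)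
    exists (translate g^-1%g @^-1` (saturation B `|` ~` saturation D)).
      by apply/null_paths_translate/null_pathsU => //; exact: null_saturation.
    move=> y Ay /=.
    have [[k _ Dk]|] := pselect (saturation D (translate g^-1%g y)); last by right.
    left; exists k => //=; apply: sub; split => //=.
    have yE : path_shift (- k)%R (translate g (path_shift k (translate g^-1%g y))) = y.
      rewrite [translate g _](_ : _ = path_shift k (translate g (translate g^-1%g y))) //.
      by rewrite translateM mulgV translate1 path_shiftD addNr path_shift0.
    by rewrite (@domain_actionE _ _ _ _ (- k)%R) yE //; exact: AD.
  - exact: AD.
  - move=> B B0 sub; apply/qlaw_negligibleP; first by move=> x [].
    exists (translate g @^-1` (saturation B `|` ~` saturation D)).
      by apply/null_paths_translate/null_pathsU => //; exact: null_saturation.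
    move=> x [Dx Ax] /=.
    have [[k _ Dk]|] := pselect (saturation D (translate g x)); last by right.
    by left; exists k => //=; apply: sub; rewrite -(domain_actionE Dk).
(* [A1] is the shift-saturation of [A], and [A2] the largest subset of [A1] invariant under [G]. *)
pose A1 := saturation A.
pose A2 := ~` (\bigcup_h translate h @^-1` (~` A1)).
have mA1 : measurable A1 by exact: measurable_saturation.
have mA2 : measurable A2.
  apply: measurableC; apply: countable_bigcupT_measurable => // h.
  by apply: mtrans; exact: measurableC.
have A2P x : A2 x <-> forall h, A1 (translate h x).
  split => [nx h|xh [h _ nh]]; last exact: nh.
  by apply: contrapT => nh; apply: nx; exists h.
have A1shift k x : A1 x -> A1 (path_shift k x).
  by case=> l _ Al; exists (l - k)%R => //=; rewrite path_shiftD subrK.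
have A2trans h x : A2 x -> A2 (translate h x).
  by move/A2P => Ax; apply/A2P => g; rewrite translateM.
have A2shift k x : A2 x -> A2 (path_shift k x).
  by move/A2P => Ax; apply/A2P => g; exact: (A1shift k _ (Ax g)).
have A12 : null_paths (A1 `\` A2).
  have inv' h : exists B,
      null_paths B /\ A `+` (D `&` domain_action dG h @^-1` A) `<=` B.
    have /qlaw_negligibleP[|B B0 sub] := inv h; last by exists B.
    by move=> x [[/AD//]|[[]]].
  have [N NP] := choice inv'.
  apply: null_pathsS (null_paths_bigcup (F := fun h => saturation (N h) `|`
      translate h @^-1` (~` saturation D)) cG _); first exact: measurableD.
    move=> x [[k _ Ak] nA2]; apply: contrapT => nx; apply: nA2; apply/A2P => h.
    have [[j _ Dj]|nj] := pselect (saturation D (translate h x)); last first.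
      by exfalso; apply: nx; exists h => //; right.
    have Dj' : D (path_shift (j - k)%R (translate h (path_shift k x))).
      rewrite [translate h _](_ : _ = path_shift k (translate h x)) //.
      by rewrite path_shiftD subrK.
    (* The domain points on the orbits of x and of its translate by h correspond under the action of
       h. If only the first lies in [A], it belongs to the null set [N h]. *)
    exists j => //=; apply: contrapT => nAj; apply: nx; exists h => //; left.
    exists k => //=; apply: (proj2 (NP h)); left; split => // -[_] /=.
    rewrite (domain_actionE Dj').
    rewrite [translate h _](_ : _ = path_shift k (translate h x)) //.
    by rewrite path_shiftD subrK.
  move=> h; apply: null_pathsU; last exact: outside.
  exact/null_saturation/(proj1 (NP h)).
have [A20|A20] := invariant_paths_null_or_conull mA2 A2trans A2shift; [left|right].
  apply/esum_plaw_null; first exact: measurableI.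
  apply: null_pathsS (null_pathsU A20 A12); first exact: measurableI.
  move=> x [Ax _]; have [xA2|nA2] := pselect (A2 x); [by left|right; split => //].
  by exists 0%R => //=; rewrite path_shift0.
apply/esum_plaw_null; first by apply: measurableI => //; exact: measurableD.
apply: null_pathsS A20; first by apply: measurableI => //; exact: measurableD.
(* Each shift orbit has at most one point in the domain, so a domain point in [A1] is already in
   [A]. *)
move=> x [[Dx nAx] _] /A2P/(_ 1%g); rewrite translate1 => -[k _ Ak]; apply: nAx.
have k0 : k = 0%R by exact: fundamental_domain_unique Dx (AD _ Ak).
by move: Ak; rewrite k0 /= path_shift0.
Qed.

End ergodic_actions.

(** * From the given walks to the canonical increments, and conclusion *)

Lemma canonical_law d (T : measurableType d) (R : realType) (P : probability T R)
    (G : groupType) (mu : G -> R) (V : int -> T -> G) : iid P mu V ->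
  exists2 nu : probability (bipath G) R, iid nu mu (fun z (u : bipath G) => u z) &
    forall B : set (bipath G), measurable B -> nu B = P [set t | B (V^~ t)].
Proof.
move=> iV; have mV := measurable_iid iV.
pose X : {mfun T >-> bipath G} := mfun_Sub (mem_set mV).
exists (distribution P X) => //; case: iV => _ lawV indV; split.
- by move=> z; exact: G_random_variable_coord.
- by move=> z A; exact: (lawV z A).
- by move=> J A uJ; exact: (indV J A uJ).
Qed.

(** Outside a window from -N to N the values are below [f 0], so the maximum is attained inside and
    has a first occurrence. *)
Lemma first_maximum (R : realType) (f : int -> R) : (forall z, 0 < f z) ->
  (forall e, 0 < e -> exists N : nat, forall z : int, (N <= absz z)%N -> f z < e) ->
  exists j : int, (forall z, z < j -> f z < f j) /\ (forall z, j < z -> f z <= f j).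
Proof.
move=> f0 fvan; have [N hN] := fvan (f 0) (f0 0).
pose F (i : 'I_(N + N).+1) := f (i%:Z - N%:Z).
have [M maxM] : exists M, forall i, F i <= F M.
  by case: (@arg_maxP _ _ _ ord0 xpredT F isT) => M _ maxM; exists M => i;
    exact: maxM.
have maxf z : f z <= F M.
  have inside y : (absz y <= N)%N -> f y <= F M.
    move=> yN; have lt : (absz (y + N%:Z)%R < (N + N).+1)%N by lia.
    have e : (absz (y + N%:Z))%:Z - N%:Z = y by lia.
    by have := maxM (Ordinal lt); rewrite [F (Ordinal lt)]/F /= e.
  have [|/ltnW/hN lt] := leqP (absz z) N; first exact: inside.
  by apply: le_trans (ltW lt) _; apply: inside.
(* The search for the first maximum starts at time -N; earlier times are excluded by the choice of
   [N]. *)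
have exP : exists i : nat, F M <= f (i%:Z - N%:Z) by exists M.
have [i Mi mini] := ex_minnP exP.
exists (i%:Z - N%:Z); split => z zj; last exact: le_trans (maxf z) Mi.
have [zN|zN] := leP (- N%:Z) z; last first.
  by apply: lt_le_trans (hN z _) (le_trans (maxf 0) Mi); lia.
rewrite ltNge; apply/negP => le.
have := mini (absz (z + N%:Z)); rewrite (_ : (absz (z + N%:Z))%:Z - N%:Z = z);
  last by lia.
by move=> /(_ (le_trans Mi le)); lia.
Qed.

Section reachability.
Local Open Scope ereal_scope.
Context (R : realType) (G : groupType) (mu : G -> R) (S : set G).
Hypothesis cG : countable [set: G].
Hypothesis hmu : prob_mass mu.
Hypothesis sym_mu : forall g, mu (g^-1)%g = mu g.
Hypothesis symS : symmetric_set S.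
Hypothesis genS : generating S.
Hypothesis supp_mu : mass_support mu = S.
Context (nu : probability (bipath G) R).
Hypothesis iid_nu : iid nu mu (fun z (u : bipath G) => u z).

(** Induction on a word for y: each letter or its inverse lies in the symmetric support, so by the
    Markov property every further letter keeps the probability positive. *)
Lemma reachable y : exists n, nu (at_time (1%g : G) n y) != 0.
Proof.
have [w wS ->] := genS y; exists (size w); elim/last_ind: w wS => [_|w s IHw wS].
  rewrite big_nil (_ : at_time _ _ _ = setT) ?probability_setT ?onee_neq0 //.
  by apply/seteqP; split => // u _; rewrite /at_time /= path_of0.
rewrite size_rcons big_rcons; set y' := (\prod_(i <- w) i)%g.
have y'0 : nu (at_time 1%g (size w) y') != 0.
  by apply: IHw => x xw; apply: wS; rewrite mem_rcons inE xw orbT.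
have Ss : mu s != 0%R.
  suff : mass_support mu s by [].
  rewrite supp_mu; by have [|//|/symS] := wS s; rewrite ?mem_rcons ?mem_head ?invgK.
pose C : set (bipath G) := [set u | u 0%R = s].
have mC : measurable C by exact: (@G_random_variable_coord G 0 [set s]).
have Cs : nu C != 0.
  have [_ lawV _] := iid_nu.
  have -> : nu C = (mu s)%:E.
    by have := lawV 0%R [set s]; rewrite esum_set1 // lee_fin; exact: (proj1 hmu).
  by rewrite eqe.
have := markov_property hmu sym_mu iid_nu (measurable_at_time cG 1%g (size w) y') mC
  (@determined_at_time _ 1%g (size w) y').
have detC : determined (future 0) C by move=> u v uv; rewrite /C /= uv.
move=> /(_ detC) nuE.
apply: contraTneq (mule_neq0 y'0 Cs) => n0; rewrite negbK -nuE; apply/eqP.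
apply: subset_measure0 n0.
- apply: measurableI; first exact: measurable_at_time.
  exact: preimage_measurable (@measurable_shift G _) mC.
- exact: measurable_at_time.
move=> u [uw]; rewrite /C /path_shift /= opprK add0r => us.
by rewrite /at_time /= -addn1 PoszD path_ofS uw us.
Qed.

End reachability.

Theorem theorem2p3 (R : realType) (G : groupType) (S : set G) (mu : G -> R)
    (d : measure_display) (Omega : measurableType d) (P : probability Omega R)
    (Y Y' : nat -> Omega -> G)
    (hG : hyperbolic_group R G) (hne : ~ elementary G)
    (finS : finite_set S) (symS : symmetric_set S) (genS : generating S)
    (hmu : prob_mass mu) (sym_mu : forall g, mu (g^-1)%g = mu g)
    (supp_mu : mass_support mu = S)
    (hY : two_walk_steps P mu Y Y') :
  ergodic (fundamental_domain (green_dist P Y)) (domain_action (green_dist P Y))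
    (quotient_measure P Y Y')
  /\
  ergodic (@based_paths G) (@tau G) (path_law P Y Y' 1%g).
Proof.
have cG := generating_countable finS genS.
pose idx (z : int) : nat + nat := match z with Posz n => inl n | Negz n => inr n end.
have idx_inj : injective idx by move=> [m|m] [n|n] // [->].
(* The steps of the backward walk are read in reverse, so they enter the increments as inverses. *)
pose past_sign (z : int) := if z is Negz _ then true else false.
have iV := iid_signed_reindex sym_mu past_sign idx_inj hY.
set V := (fun _ _ => _) in iV.
have [nu iid_nu nuE] := canonical_law iV.
have bilateralE g t : bilateral_walk Y Y' g t = path_of g (V^~ t).
  apply/funext => -[n|n] //; rewrite /path_of /= /walk; congr (_ * _)%g.
  by apply: eq_bigr => i _; rewrite invgK.
have plawE g B : measurable B -> path_law P Y Y' g B = nu (path_of g @^-1` B).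
  move=> mB; rewrite nuE; last exact: preimage_measurable (measurable_path_of cG g) mB.
  by congr (P _); apply/seteqP; split => t /=; rewrite bilateralE.
split; last exact (tau_ergodic cG hmu sym_mu iid_nu plawE).
have greenE y : green_dist P Y y 1%g = - ln (hit_prob nu y).
  rewrite /green_dist /hitting_prob /hit_prob nuE; last exact: measurable_hits.
  congr (- ln (fine (P _))); apply/seteqP; split => t [n]; first by exists n.
  by move=> _; exists n.
have reach := reachable cG hmu sym_mu symS genS supp_mu iid_nu.
have [[y hy]|nohy] := pselect (exists y, hit_prob nu y < 1); last first.
  apply: (domain_action_ergodic_empty cG plawE).
  (* With F(.,o) identically 1 the Green distance to the identity vanishes, and the strict
     inequality at time -1 fails. *)
  rewrite -subset0 => x [/(_ (-1) isT) + _]; rewrite !greenE.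
  have hit1 g : hit_prob nu g = 1.
    apply/eqP; rewrite eq_le (hit_prob_le1 cG) leNgt; apply/negP => lt.
    by apply: nohy; exists g.
  by rewrite !hit1 ltxx.
apply: (domain_action_ergodic cG hmu sym_mu iid_nu plawE).
have transient := no_return_pos hmu sym_mu iid_nu cG reach hy.
have mD : measurable (saturation (fundamental_domain (green_dist P Y))).
  exact: (measurable_saturation (measurable_fundamental_domain cG _)).
split; first exact: measurableC.
move=> g; have [Z [mZ Z0] van] := hit_prob_vanishes hmu sym_mu iid_nu cG transient g.
apply: subset_measure0 Z0 => //.
  by apply: (preimage_measurable (measurable_path_of cG g)); exact: measurableC.
move=> u noD; apply: contrapT => nZ; apply: noD.
have pos := hit_prob_gt0 cG reach.
have [j [ltj gtj]] := first_maximum (fun z => pos (path_of g u z)) (van u nZ).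
(* The first maximum of the hitting probability is the first minimum of the Green distance; shifting
   by -j moves it to time 0. *)
exists (- j) => //; split => z z0; rewrite !greenE /path_shift sub0r !opprK.
- by rewrite ltrN2 ltr_ln ?posrE // ltj //; lia.
- by rewrite lerN2 ler_ln ?posrE // gtj //; lia.
Qed.
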